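(* Consider the SC-ABD algorithm (described in the context) running in an asynchronous message-passing system of $n$ processes with reliable links, in which processes may crash (crash-stop) and at most $f$ processes are faulty in any execution, where $f < n/2$. Then SC-ABD is a correct implementation of sequentially consistent distributed shared memory, i.e., it satisfies both: (Termination) if a correct process invokes an operation, then that operation eventually completes; and (Sequential Consistency) every (complete) history corresponding to an execution of the algorithm is sequentially consistent.
   Context: System model: $n$ processes $p_1,\dots,p_n$, $\Pi=\{1,\dots,n\}$, asynchronous, communicating over reliable point-to-point links. A process is correct if it never crashes, otherwise faulty; a crashed process stops taking steps forever. At most $f<n/2$ processes are faulty in any execution. Shared memory: a collection of read/write registers, each holding an integer, initially $0$. Operations are READ($r$) (returns a value) and WRITE($r,v$) (returns OK). Each process has at most one outstanding operation at a time. A history is the sequence of invocation and response events of operations, ordered by the real time at which they occur; only complete histories (every invoked operation has its response) are considered. $H|p_i$ denotes the subsequence of events at $p_i$. A history is sequential if it starts with an invocation and each invocation (except possibly the last) is immediately followed by its matching response; histories considered are well-formed (each $H|p_i$ is sequential). $H\simeq H'$ (equivalent) iff $H|p_i=H'|p_i$ for all $i$. A sequential history is legal if every read of a register returns the value of the closest preceding write to that register in the sequence, or $0$ if none. $H$ is sequentially consistent iff there exists a legal sequential history $S$ with $S\simeq H$. Algorithm SC-ABD (code for $p_i$). Local variables: logical clock $lt$ (initially $0$); request id $rid$ (initially $0$); map $tvps$ from registers to timestamp-value pairs, initially $((0,0),0)$ for every register; set $responses$ (initially empty); boolean $reading$; temporaries $rreg,rval$. Timestamps are pairs (integer, process id),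 compared lexicographically; timestamp-value pairs are compared by their timestamp (then value). Every message carries the sender's current $lt$; ''bcast $m$'' means send $m$ to every $p_j$, $j\in\Pi$ (including itself). Handlers: - READ($r$) invoked: $lt\gets lt+1$; $reading\gets true$; $rreg\gets r$; $rid\gets rid+1$; bcast (''query'', $lt$, $rid$, $r$). - On (''query'', $lt'$, $rid'$, $r$) from $p_j$: $lt\gets\max(lt,lt')+1$; send (''response'', $lt$, $rid'$, $tvps[r]$) to $p_j$. - On (''response'', $lt'$, $rid'$, $tsv'$) from $p_j$ with $rid=rid'$: $lt\gets\max(lt,lt')+1$; $responses\gets responses\cup\{(tsv',j)\}$; if $|responses|=\lfloor n/2\rfloor+1$: let $tsv=(ts,rval)$ be the pair with maximal timestamp among the received ones; $responses\gets\{\}$; $rid\gets rid+1$; bcast (''update'', $lt$, $rid$, $rreg$, $tsv$). - WRITE($r,v$) invoked: $lt\gets lt+1$; $reading\gets false$; $tsv\gets((lt,i),v)$; $rid\gets rid+1$; bcast (''update'', $lt$, $rid$, $r$, $tsv$). - On (''update'', $lt'$, $rid'$, $r$, $tsv'$) from $p_j$: $lt\gets\max(lt,lt')+1$; $tvps[r]\gets\max(tvps[r],tsv')$; send (''ack'', $lt$, $rid'$) to $p_j$. - On (''ack'', $lt'$, $rid'$) from $p_j$ with $rid=rid'$: $lt\gets\max(lt,lt')+1$; $responses\gets responses\cup\{j\}$; if $|responses|=\lfloor n/2\rfloor+1$: $responses\gets\{\}$; $rid\gets rid+1$; if $reading$ then return $rval$ else return OK. *)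

(* Defs.v *)
From mathcomp Require Import all_boot all_order all_algebra.
Set Implicit Arguments. Unset Strict Implicit. Unset Printing Implicit Defensive.
Import Order.TTheory GRing.Theory Num.Theory.

Definition pid := nat.
Definition reg := nat.
Definition value := int.
Definition timestamp := (nat * nat)%type.      (* (integer, process id) *)
Definition tsv := (timestamp * value)%type.

Definition tsv_le (x y : tsv) : bool :=
  let: ((a, b), v) := x in
  let: ((a', b'), v') := y in
  (a < a')%N || ((a == a') && ((b < b')%N || ((b == b') && (v <= v')%R))).

Definition tsv_max (x y : tsv) : tsv := if tsv_le x y then y else x.

Definition tsv0 : tsv := ((0%N, 0%N), Posz 0).

Definition max_tsv (s : seq tsv) : tsv := foldl tsv_max (head tsv0 s) s.

Definition fupd {T : Type} (f : nat -> T) (i : nat) (x : T) : nat -> T :=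
  fun j => if j == i then x else f j.

Inductive message :=
| MQuery    of nat & nat & reg          (* ("query",    lt, rid, r)      *)
| MResponse of nat & nat & tsv          (* ("response", lt, rid, tsv)    *)
| MUpdate   of nat & nat & reg & tsv    (* ("update",   lt, rid, r, tsv) *)
| MAck      of nat & nat.               (* ("ack",      lt, rid)         *)

Inductive operation := OpRead of reg | OpWrite of reg & value.
Inductive result := ResVal of value | ResOK.

Inductive event := EvInv of pid & operation | EvResp of pid & result.

Definition ev_pid (e : event) : pid :=
  match e with EvInv i _ => i | EvResp i _ => i end.

(* [responses] is the set "responses": a query response (tsv', j) is  *)
(* stored as (Some tsv', j), an ack from j as (None, j).              *)
(* [busy] is auxiliary (not part of the algorithm): it records that   *)
(* the process has an outstanding operation, so that the environment  *)
(* invokes at most one operation at a time per process.               *)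
Record pstate := PState {
  clk : nat;
  rid : nat;
  tvps : reg -> tsv;
  responses : seq (option tsv * pid);
  reading : bool;
  rreg : reg;
  rval : value;
  busy : bool }.

Definition pstate_init : pstate :=
  PState 0 0 (fun _ => tsv0) [::] false 0 (Posz 0) false.

Definition add_resp (x : option tsv * pid) (s : seq (option tsv * pid)) :=
  if x \in s then s else x :: s.

Definition quorum (n : nat) : nat := n./2.+1.

Definition bcast (n : nat) (m : message) : seq (pid * message) :=
  [seq (j, m) | j <- iota 0 n].

Definition on_invoke (n : nat) (i : pid) (s : pstate) (op : operation)
  : pstate * seq (pid * message) :=
  match op with
  | OpRead r =>
      let l := (clk s).+1 in let rd := (rid s).+1 in
      (PState l rd (tvps s) (responses s) true r (rval s) true,
       bcast n (MQuery l rd r))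
  | OpWrite r v =>
      let l := (clk s).+1 in let rd := (rid s).+1 in
      (PState l rd (tvps s) (responses s) false (rreg s) (rval s) true,
       bcast n (MUpdate l rd r ((l, i), v)))
  end.

Definition on_receive (n : nat) (i : pid) (s : pstate) (j : pid) (m : message)
  : pstate * seq (pid * message) * option result :=
  match m with
  | MQuery l' rd' r =>
      let l := (maxn (clk s) l').+1 in
      (PState l (rid s) (tvps s) (responses s) (reading s) (rreg s) (rval s) (busy s),
       [:: (j, MResponse l rd' (tvps s r))], None)
  | MResponse l' rd' x =>
      if rid s == rd' then
        let l := (maxn (clk s) l').+1 in
        let resp := add_resp (Some x, j) (responses s) in
        if size resp == quorum n then
          let t := max_tsv (pmap (fun e : option tsv * pid => e.1) resp) in
          let rd := (rid s).+1 in
          (PState l rd (tvps s) [::] (reading s) (rreg s) t.2 (busy s),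
           bcast n (MUpdate l rd (rreg s) t), None)
        else
          (PState l (rid s) (tvps s) resp (reading s) (rreg s) (rval s) (busy s),
           [::], None)
      else (s, [::], None)
  | MUpdate l' rd' r x =>
      let l := (maxn (clk s) l').+1 in
      (PState l (rid s) (fupd (tvps s) r (tsv_max (tvps s r) x)) (responses s)
              (reading s) (rreg s) (rval s) (busy s),
       [:: (j, MAck l rd')], None)
  | MAck l' rd' =>
      if rid s == rd' then
        let l := (maxn (clk s) l').+1 in
        let resp := add_resp (None, j) (responses s) in
        if size resp == quorum n then
          (PState l (rid s).+1 (tvps s) [::] (reading s) (rreg s) (rval s) false,
           [::], Some (if reading s then ResVal (rval s) else ResOK))
        else
          (PState l (rid s) (tvps s) resp (reading s) (rreg s) (rval s) (busy s),
           [::], None)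
      else (s, [::], None)
  end.

(* Links: every sent message becomes a uniquely identified packet in  *)
(* transit; it is delivered (at most once, in any order) by a         *)
(* [LDeliver] step.  Crashed processes take no more steps.            *)
Record packet := Packet { pkt_id : nat; pkt_src : pid; pkt_dst : pid; pkt_msg : message }.

Record config := Config {
  cst : pid -> pstate;
  ccrashed : pid -> bool;
  cnet : seq packet;
  cnext : nat }.

Definition init_config : config :=
  Config (fun _ => pstate_init) (fun _ => false) [::] 0.

Fixpoint mk_packets (next : nat) (src : pid) (out : seq (pid * message)) : seq packet :=
  match out with
  | [::] => [::]
  | (d, m) :: t => Packet next src d m :: mk_packets next.+1 src t
  end.

Inductive label :=
| LInvoke of pid & operation
| LDeliver of nat
| LCrash of pid
| LIdle.

Definition step (n : nat) (c : config) (l : label) : option (config * option event) :=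
  match l with
  | LInvoke i op =>
      if [&& (i < n)%N, ~~ ccrashed c i & ~~ busy (cst c i)] then
        let: (s', out) := on_invoke n i (cst c i) op in
        Some (Config (fupd (cst c) i s') (ccrashed c)
                     (cnet c ++ mk_packets (cnext c) i out) (cnext c + size out),
              Some (EvInv i op))
      else None
  | LDeliver k =>
      match [seq p <- cnet c | pkt_id p == k] with
      | p :: _ =>
          let d := pkt_dst p in
          if ~~ ccrashed c d then
            let: (s', out, res) := on_receive n d (cst c d) (pkt_src p) (pkt_msg p) in
            Some (Config (fupd (cst c) d s') (ccrashed c)
                         ([seq q <- cnet c | pkt_id q != k] ++ mk_packets (cnext c) d out)
                         (cnext c + size out),
                  omap (EvResp d) res)
          else None
      | [::] => None
      end
  | LCrash i =>
      if (i < n)%N && ~~ ccrashed c i then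
        Some (Config (cst c) (fupd (ccrashed c) i true) (cnet c) (cnext c), None)
      else None
  | LIdle => Some (c, None)
  end.

Fixpoint run (n : nat) (c : config) (ls : seq label) : option (config * seq event) :=
  match ls with
  | [::] => Some (c, [::])
  | l :: t =>
      match step n c l with
      | None => None
      | Some (c', e) =>
          match run n c' t with
          | None => None
          | Some (c'', h) => Some (c'', if e is Some ev then ev :: h else h)
          end
      end
  end.

Definition ncrashed (n : nat) (c : config) : nat := count (ccrashed c) (iota 0 n).

Definition is_execution (n : nat) (c : nat -> config) (ls : nat -> label)
    (ev : nat -> option event) : Prop :=
  c 0 = init_config /\ forall k, step n (c k) (ls k) = Some (c k.+1, ev k).

Definition correct_in (c : nat -> config) (i : pid) : Prop :=
  forall k, ~~ ccrashed (c k) i.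

Definition reliable_links (c : nat -> config) (ls : nat -> label) : Prop :=
  forall k p, (exists s1 s2, cnet (c k) = s1 ++ p :: s2) ->
    correct_in c (pkt_src p) -> correct_in c (pkt_dst p) ->
    exists k', (k <= k')%N /\ ls k' = LDeliver (pkt_id p).

Definition proj (i : pid) (H : seq event) : seq event :=
  [seq e <- H | ev_pid e == i].

Definition matches (op : operation) (r : result) : bool :=
  match op, r with
  | OpRead _, ResVal _ => true
  | OpWrite _ _, ResOK => true
  | _, _ => false
  end.

Definition complete (H : seq event) : Prop :=
  forall i k j op, onth (proj i H) k = Some (EvInv j op) ->
    exists r, onth (proj i H) k.+1 = Some (EvResp i r) /\ matches op r.

Fixpoint sequential (S : seq event) : bool :=
  match S with
  | [::] => true
  | [:: EvInv _ _] => true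
  | EvInv p op :: EvResp q r :: t => [&& p == q, matches op r & sequential t]
  | _ => false
  end.

Fixpoint legal_from (mem : reg -> value) (S : seq event) : bool :=
  match S with
  | EvInv _ (OpRead r) :: EvResp _ (ResVal v) :: t => (v == mem r) && legal_from mem t
  | EvInv _ (OpWrite r v) :: EvResp _ ResOK :: t => legal_from (fupd mem r v) t
  | _ => true
  end.

Definition legal (S : seq event) : bool := legal_from (fun _ => Posz 0) S.

Definition hequiv (H H' : seq event) : Prop := forall i, proj i H = proj i H'.

Definition seq_consistent (H : seq event) : Prop :=
  exists S, [/\ sequential S, legal S & hequiv S H].

Definition Termination (n f : nat) : Prop :=
  forall (c : nat -> config) (ls : nat -> label) (ev : nat -> option event),
    is_execution n c ls ev ->
    (forall k, (ncrashed n (c k) <= f)%N) ->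
    reliable_links c ls ->
    forall k i op, ev k = Some (EvInv i op) -> correct_in c i ->
      exists k' r, (k < k')%N /\ ev k' = Some (EvResp i r).

Definition SequentialConsistency (n f : nat) : Prop :=
  forall (ls : seq label) (c : config) (H : seq event),
    run n init_config ls = Some (c, H) ->
    (ncrashed n c <= f)%N ->
    complete H ->
    seq_consistent H.

(* Main.v *)
Require Import Defs.
From HB Require Import structures.
From Stdlib Require Import Classical.
From mathcomp Require Import all_boot all_order all_algebra zify.
Set Implicit Arguments. Unset Strict Implicit. Unset Printing Implicit Defensive.

(** Sequential consistency allows operations to be reordered along Lamport
    clocks: if [o_inv o] and [o_resp o] are the clocks of the calling process at
    the invocation and at the response of [o], then on each process an operation
    responds strictly before the next one is invoked, in clock time as well. In
    that time the algorithm behaves like atomic ABD. If [a] and [b] access the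
    same register and [o_resp a < o_inv b], then some server both acknowledged
    the update of [a] and answered the query of [b], at clocks placing the
    update first, so [b] reads a pair at least as large as that of [a]; and if
    [b] is a write, its timestamp is its invocation clock, which exceeds the
    timestamp of [a]. Hence every operation can be placed at a clock value
    between its invocation and its response so that, on each register, a read is
    preceded by exactly the writes carrying smaller or equal pairs.

    Termination: while a client is waiting, each server has exactly one of the
    request, the reply in transit, and the reply recorded by the client, so if
    the request identifier never changed, all correct servers, which form a
    quorum, would eventually be recorded. *)

(** * Ordering operations by logical clocks *)

Lemma tsv_le_refl : reflexive tsv_le.
Proof. by move=> [[a b] v]; rewrite /tsv_le; lia. Qed.

Lemma tsv_le_trans : transitive tsv_le.
Proof. by move=> [[a b] v] [[a' b'] v'] [[a2 b2] v2]; rewrite /tsv_le; lia. Qed.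

Lemma tsv_le_total : total tsv_le.
Proof. by move=> [[a b] v] [[a' b'] v']; rewrite /tsv_le; lia. Qed.

Lemma tsv_le_anti : antisymmetric tsv_le.
Proof.
move=> [[a b] v] [[a' b'] v']; rewrite /tsv_le => h.
have [-> [-> ->]] : a = a' /\ b = b' /\ v = v' by lia.
by [].
Qed.

Lemma tsv_lt_clock x y : x.1.1 < y.1.1 -> ~~ tsv_le y x.
Proof. by move: x y => [[a b] v] [[a' b'] v']; rewrite /tsv_le /=; lia. Qed.

Lemma tsv_le_maxl x y : tsv_le x (tsv_max x y).
Proof. by rewrite /tsv_max; case: ifP => // _; apply: tsv_le_refl. Qed.

Lemma tsv_le_maxr x y : tsv_le y (tsv_max x y).
Proof.
rewrite /tsv_max; case: ifP => [_|h]; first exact: tsv_le_refl.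
by have := tsv_le_total x y; rewrite h.
Qed.

Lemma tsv_maxP (P : tsv -> Prop) x y : P x -> P y -> P (tsv_max x y).
Proof. by rewrite /tsv_max; case: ifP. Qed.

Lemma max_tsv_ge (s : seq tsv) y : y \in s -> tsv_le y (max_tsv s).
Proof.
rewrite /max_tsv.
have ge0 t a : tsv_le a (foldl tsv_max a t).
  elim: t a => [|z t IH] a /=; first exact: tsv_le_refl.
  exact: tsv_le_trans (tsv_le_maxl a z) (IH _).
elim: s (head tsv0 s) => [//|z s IH] a; rewrite inE => /orP [/eqP->|/IH] //=.
exact: tsv_le_trans (tsv_le_maxr _ _) (ge0 _ _).
Qed.

Lemma max_tsv_mem (s : seq tsv) : s != [::] -> max_tsv s \in s.
Proof.
case: s => // z s _; rewrite /max_tsv /=.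
have -> : tsv_max z z = z by rewrite /tsv_max if_same.
elim: s z => [|y s IH] z /=; first by rewrite inE.
have := IH (tsv_max z y); rewrite !inE => /orP [/eqP ->|->]; last by rewrite !orbT.
by rewrite /tsv_max; case: ifP; rewrite eqxx ?orbT.
Qed.

(** Two disjoint quorums would give a duplicate-free list of [2 * (n./2 + 1) > n] identifiers below
    [n]. *)
Lemma quorum_intersect n (s t : seq nat) :
  uniq s -> uniq t -> all (gtn n) s -> all (gtn n) t ->
  size s = quorum n -> size t = quorum n -> exists2 q, q \in s & q \in t.
Proof.
move=> us ut sn tn zs zt; apply/hasP; apply: contraT; rewrite -all_predC => /allP dis.
have : uniq (t ++ s) by rewrite cat_uniq ut us -all_predC !andbT; apply/allP.
move/(uniq_leq_size (s2 := iota 0 n))/(_ _); rewrite size_cat size_iota zs zt /quorum.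
move=> h; have: (n./2.+1 + n./2.+1 <= n); last lia.
apply: h => x; rewrite mem_cat mem_iota add0n /=.
by move=> /orP [/(allP tn)|/(allP sn)].
Qed.

(** * Decidable equality for operations, messages and packets *)

Definition operation_code (op : operation) : reg + reg * value :=
  match op with OpRead r => inl r | OpWrite r v => inr (r, v) end.
Definition operation_decode (x : reg + reg * value) : operation :=
  match x with inl r => OpRead r | inr (r, v) => OpWrite r v end.
Lemma operation_codeK : cancel operation_code operation_decode.
Proof. by case. Qed.
HB.instance Definition _ := Equality.copy operation (can_type operation_codeK).

Definition message_code (m : message) :=
  match m with
  | MQuery l rd r => inl (inl (l, rd, r))
  | MResponse l rd x => inl (inr (l, rd, x))
  | MUpdate l rd r x => inr (inl (l, rd, r, x))
  | MAck l rd => inr (inr (l, rd))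
  end.
Definition message_decode m :=
  match m with
  | inl (inl (l, rd, r)) => MQuery l rd r
  | inl (inr (l, rd, x)) => MResponse l rd x
  | inr (inl (l, rd, r, x)) => MUpdate l rd r x
  | inr (inr (l, rd)) => MAck l rd
  end.
Lemma message_codeK : cancel message_code message_decode.
Proof. by case. Qed.
HB.instance Definition _ := Equality.copy message (can_type message_codeK).

Definition packet_code (p : packet) := (pkt_id p, pkt_src p, pkt_dst p, pkt_msg p).
Definition packet_decode x := let: (k, i, j, m) := x in Packet k i j m.
Lemma packet_codeK : cancel packet_code packet_decode.
Proof. by case. Qed.
HB.instance Definition _ := Equality.copy packet (can_type packet_codeK).

(** * Sequential histories built from operation records *)

Definition is_write (op : operation) : bool :=
  if op is OpWrite _ _ then true else false.
Definition op_reg (op : operation) : reg :=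
  match op with OpRead r => r | OpWrite r _ => r end.

(* A completed operation, annotated with the logical clock of its process at
   its invocation and at its response, and with the pair it wrote or read. *)
Record oprec := OpRec {
  o_pid : pid; o_op : operation; o_inv : nat; o_resp : nat; o_tsv : tsv }.

Definition oprec_code (o : oprec) := (o_pid o, o_op o, o_inv o, o_resp o, o_tsv o).
Definition oprec_decode x := let: (i, op, a, b, t) := x in OpRec i op a b t.
Lemma oprec_codeK : cancel oprec_code oprec_decode.
Proof. by case. Qed.
HB.instance Definition _ := Equality.copy oprec (can_type oprec_codeK).

Definition o_write (o : oprec) : bool := is_write (o_op o).
Definition o_reg (o : oprec) : reg := op_reg (o_op o).
Definition o_res (o : oprec) : result :=
  if o_write o then ResOK else ResVal (o_tsv o).2.
Definition o_events (o : oprec) : seq event :=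
  [:: EvInv (o_pid o) (o_op o); EvResp (o_pid o) (o_res o)].
Definition events (s : seq oprec) : seq event := flatten [seq o_events o | o <- s].

Lemma events_rcons s o : events (rcons s o) = events s ++ o_events o.
Proof. by rewrite /events map_rcons flatten_rcons. Qed.

Lemma proj_events i s : proj i (events s) = events [seq o <- s | o_pid o == i].
Proof.
elim: s => [|o s IH] //; rewrite /proj /events /= in IH *.
by case: (o_pid o == i) => /=; rewrite IH.
Qed.

Lemma sequential_events s : sequential (events s).
Proof.
elim: s => // o s IH; rewrite /events /= in IH *; rewrite eqxx IH andbT.
by rewrite /o_res /o_write; case: (o_op o).
Qed.

Definition mem_step (m : reg -> value) (o : oprec) : reg -> value :=
  if o_write o then fupd m (o_reg o) (o_tsv o).2 else m.

(** Reduces legality to one condition per read, on the memory left by the operations before it. As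
    [mem_step] stores the value of the pair, the first hypothesis identifies it with the value
    written. *)
Lemma legal_from_events (m : reg -> value) s :
  (forall o r v, o \in s -> o_op o = OpWrite r v -> (o_tsv o).2 = v) ->
  (forall s1 o s2, s = s1 ++ o :: s2 -> ~~ o_write o ->
     (o_tsv o).2 = foldl mem_step m s1 (o_reg o)) ->
  legal_from m (events s).
Proof.
elim: s m => // o s IH m wv rv.
have wv' o' r v : o' \in s -> o_op o' = OpWrite r v -> (o_tsv o').2 = v.
  by move=> os; apply: wv; rewrite inE os orbT.
have rv' s1 o' s2 : s = s1 ++ o' :: s2 -> ~~ o_write o' ->
    (o_tsv o').2 = foldl mem_step (mem_step m o) s1 (o_reg o').
  by move=> es; apply: (rv (o :: s1) o' s2); rewrite es.
have := IH _ wv' rv'; have /= := rv [::] o s erefl; have := wv o _ _ (mem_head o s).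
rewrite /events /= /mem_step /o_res /o_write /o_reg /=.
case: (o_op o) => [r _ -> // ->|r v /(_ _ _ erefl) <- _] //=.
by rewrite eqxx.
Qed.

(** Writes to [r] occur in increasing order of pairs, so the last one carries the largest pair; this
    is [t], which bounds them all and is attained. *)
Lemma foldl_mem_step (m : reg -> value) s r t :
  (forall o, o \in s -> o_write o -> o_reg o = r -> tsv_le (o_tsv o) t) ->
  pairwise (fun a b => [&& o_write a, o_write b, o_reg a == r & o_reg b == r]
              ==> tsv_le (o_tsv a) (o_tsv b)) s ->
  (exists2 w, w \in s & [/\ o_write w, o_reg w = r & o_tsv w = t]) ->
  foldl mem_step m s r = t.2.
Proof.
elim/last_ind: s => [_ _ []//|s o IH] ub; rewrite pairwise_rcons => /andP [lo pw] [w].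
rewrite foldl_rcons /mem_step.
have [/andP [wo /eqP ro]|no] := boolP (o_write o && (o_reg o == r)).
  move=> ws [ww rw tw]; rewrite wo /fupd ro eqxx; congr snd.
  apply: tsv_le_anti; rewrite ub ?mem_rcons ?mem_head //=.
  move: ws; rewrite mem_rcons inE => /orP [/eqP <-|ws]; first by rewrite tw tsv_le_refl.
  by have := allP lo _ ws; rewrite ww wo rw ro eqxx tw.
rewrite mem_rcons inE => /orP [/eqP ->|ws] [ww rw tw]; first by rewrite ww rw eqxx in no.
have -> : (if o_write o then fupd (foldl mem_step m s) (o_reg o) (o_tsv o).2
   else foldl mem_step m s) r = foldl mem_step m s r.
  by case: (o_write o) no => //=; rewrite /fupd eq_sym => /negbTE ->.
apply: IH => //; last by exists w.
by move=> o' so'; apply: ub; rewrite mem_rcons inE so' orbT.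
Qed.

Lemma foldl_mem_step_none (m : reg -> value) s r :
  (forall o, o \in s -> o_write o -> o_reg o <> r) ->
  foldl mem_step m s r = m r.
Proof.
elim: s m => // o s IH m ns /=; rewrite IH => [|o' so']; last first.
  by apply: ns; rewrite inE so' orbT.
rewrite /mem_step; case: ifP => // wo; rewrite /fupd eq_sym.
by have /eqP/negbTE -> := ns o (mem_head _ _) wo.
Qed.

(** * Linearization of operations carrying clocks and pairs *)

Section Linearization.
Variable s : seq oprec.

Let above (o : oprec) :=
  [seq o_resp o' | o' <- s & (o_reg o' == o_reg o) && tsv_le (o_tsv o) (o_tsv o')].

Let first_resp (o : oprec) := foldr minn (o_resp o) (above o).

(* The logical time at which an operation takes effect: no later than the first
   response of an operation carrying at least the same timestamp. *)
Let point (o : oprec) := maxn (o_inv o) (first_resp o).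

(** At the same point operations are ordered by pair, and at equal pairs writes precede reads, so
    that a read comes after the write it reads from. *)
Let before (a b : oprec) :=
  (point a < point b) || (point a == point b) &&
  (if o_tsv a == o_tsv b then o_write a || ~~ o_write b else tsv_le (o_tsv a) (o_tsv b)).

Lemma before_total : total before.
Proof.
move=> a b; rewrite /before; case: ltngtP => //= _.
rewrite (eq_sym (o_tsv b)); case: eqP => _; last exact: tsv_le_total.
by do 2 case: o_write.
Qed.

Lemma before_trans : transitive before.
Proof.
move=> b a c; rewrite /before.
case: (ltngtP (point a) (point b)) => [ab|//|->] /=.
  by case: (ltngtP (point b) (point c)) => [/(ltn_trans ab) ->|//|<- _]; rewrite ?ab.
case: (ltngtP (point b) (point c)) => //= _.
have [eab|nab] := eqVneq (o_tsv a) (o_tsv b); have [ebc|nbc] := eqVneq (o_tsv b) (o_tsv c).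
- by rewrite eab ebc eqxx; do 3 case: o_write.
- by rewrite eab (negbTE nbc).
- by rewrite -ebc (negbTE nab).
have [eac|_] := eqVneq (o_tsv a) (o_tsv c) => h1 h2; last exact: tsv_le_trans h1 h2.
by case/eqP: nab; apply: tsv_le_anti; rewrite h1 eac h2.
Qed.

Lemma first_resp_le o o' : o' \in s -> o_reg o' = o_reg o ->
  tsv_le (o_tsv o) (o_tsv o') -> first_resp o <= o_resp o'.
Proof.
move=> so' ro le; have : o_resp o' \in above o.
  by apply: map_f; rewrite mem_filter ro eqxx le.
rewrite /first_resp; elim: (above o) => //= y t IH.
rewrite inE geq_min => /orP [/eqP ->|/IH ->]; by rewrite ?leqnn ?orbT.
Qed.

Lemma first_respP o : o \in s ->
  exists o', [/\ o' \in s, o_reg o' = o_reg o, tsv_le (o_tsv o) (o_tsv o')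
    & first_resp o = o_resp o'].
Proof.
move=> so; have : first_resp o \in o_resp o :: above o.
  rewrite /first_resp; elim: (above o) => [|y t IH] /=; first exact: mem_head.
  rewrite /minn; case: ifP => _; first by rewrite !inE eqxx orbT.
  by move: IH; rewrite !inE => /orP [->|->]; rewrite ?orbT.
rewrite inE => /orP [/eqP ->|]; first by exists o; rewrite tsv_le_refl.
case/mapP => o'; rewrite mem_filter => /andP [/andP [/eqP ro le] so'] ->.
by exists o'.
Qed.

Hypothesis inv_le_resp : forall o, o \in s -> o_inv o <= o_resp o.
Hypothesis resp_before_inv : forall a b, a \in s -> b \in s -> o_reg a = o_reg b ->
  o_resp a < o_inv b -> if o_write b then ~~ tsv_le (o_tsv b) (o_tsv a)
                        else tsv_le (o_tsv a) (o_tsv b).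

(** Otherwise some [w'] with a pair at least that of [w] responds before [o] is invoked, and
    [resp_before_inv] pushes the pair of [o] to at least that of [w'], strictly above it if [o] is a
    write. The last hypothesis excludes only a read with exactly the pair of [w], which may start
    long after [w]. *)
Lemma inv_le_first_resp o w : o \in s -> w \in s -> o_reg o = o_reg w ->
  tsv_le (o_tsv o) (o_tsv w) -> o_write o || (o_tsv o != o_tsv w) ->
  o_inv o <= first_resp w.
Proof.
move=> so sw row le nr; have [w' [sw' rw' le' ->]] := first_respP sw.
rewrite leqNgt; apply/negP => lt.
have {lt} := resp_before_inv sw' so (etrans rw' (esym row)) lt.
have le2 := tsv_le_trans le le'.
case: ifP nr => [_ _|_ /= neq le3]; first by rewrite le2.
by case/eqP: neq; apply: tsv_le_anti; rewrite le (tsv_le_trans le' le3).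
Qed.

(** Both terms of the maximum are at most [first_resp w]: the invocation clock by
    [inv_le_first_resp], and [first_resp o] because a pair above that of [w] is also above that of
    [o]. *)
Lemma point_le o w : o \in s -> w \in s -> o_reg o = o_reg w ->
  tsv_le (o_tsv o) (o_tsv w) -> o_write o || (o_tsv o != o_tsv w) ->
  point o <= point w.
Proof.
move=> so sw row le nr; rewrite /point geq_max !leq_max.
rewrite (inv_le_first_resp so sw row le nr) orbT /=.
have [w' [sw' rw' le' ->]] := first_respP sw.
apply/orP; right; apply: first_resp_le => //; first by rewrite rw'.
exact: tsv_le_trans le le'.
Qed.

(** If the pair of [b] were smaller, [point_le] would place [b] no later than [a], and the tie-break
    would favour [b] as well. *)
Lemma before_reads_from a b : a \in s -> b \in s -> o_reg a = o_reg b ->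
  before a b -> o_write a -> tsv_le (o_tsv a) (o_tsv b).
Proof.
move=> sa sb rab bef wa; have /orP [//|le] := tsv_le_total (o_tsv a) (o_tsv b).
have [->|neq] := eqVneq (o_tsv a) (o_tsv b); first exact: tsv_le_refl.
have p : point b <= point a by apply: point_le => //; rewrite eq_sym neq orbT.
by move: bef; rewrite /before (negbTE neq) ltnNge p => /andP [].
Qed.

(** As [w] is a write, [point_le] applies even when the pairs are equal; the tie-break then puts the
    write first. *)
Lemma write_before_read w o : w \in s -> o \in s -> o_reg w = o_reg o ->
  o_write w -> ~~ o_write o -> tsv_le (o_tsv w) (o_tsv o) -> ~~ before o w.
Proof.
move=> sw so rwo ww wo le; have p : point w <= point o by apply: point_le; rewrite ?ww.
rewrite /before negb_or -leqNgt p negb_and /=.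
case: (eqVneq (o_tsv o)) => [_|neq]; first by rewrite (negbTE wo) ww orbT.
apply/orP; right; apply/negP => le'.
by case/eqP: neq; apply: tsv_le_anti; rewrite le le'.
Qed.

(** The point of an operation lies between its invocation and response clocks. *)
Lemma before_of_lt a b : a \in s -> b \in s -> o_resp a < o_inv b -> before a b.
Proof.
move=> sa sb lt; rewrite /before; apply/orP; left; rewrite /point leq_max; apply/orP; left.
rewrite gtn_max (leq_ltn_trans (inv_le_resp sa) lt).
by apply: leq_ltn_trans lt; apply: first_resp_le => //; apply: tsv_le_refl.
Qed.

Hypothesis write_value : forall o r v, o \in s -> o_op o = OpWrite r v -> (o_tsv o).2 = v.
Hypothesis read_source : forall o, o \in s -> ~~ o_write o ->
  o_tsv o = tsv0 \/ exists2 w, w \in s & [/\ o_write w, o_reg w = o_reg o & o_tsv w = o_tsv o].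
Hypothesis write_gt0 : forall o, o \in s -> o_write o -> ~~ tsv_le (o_tsv o) tsv0.

(** The second condition yields equivalence of histories when [p] selects the operations of one
    process. *)
Lemma linearization : exists s', [/\ legal (events s') &
  forall p, sorted (fun a b => o_resp a < o_inv b) (filter p s) -> filter p s' = filter p s].
Proof.
exists (sort before s); split; last first.
  (* Sorting commutes with filtering, and a sublist in clock order is already in [before] order,
     hence unchanged. *)
  move=> p srt; rewrite filter_sort; [|exact: before_total|exact: before_trans].
  apply: sorted_sort; first exact: before_trans.
  apply: (sub_in_sorted (P := mem s)) srt; first exact: before_of_lt.
  by apply/allP => x; rewrite mem_filter => /andP [].
apply: legal_from_events => [o r v|s1 o s2 es wo]; first by rewrite mem_sort; apply: write_value.
have mems x : (x \in s1 ++ o :: s2) = (x \in s) by rewrite -es mem_sort.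
have so : o \in s by rewrite -mems mem_cat mem_head orbT.
have s1s x : x \in s1 -> x \in s by move=> xs1; rewrite -mems mem_cat xs1.
have : pairwise before (s1 ++ o :: s2).
  by rewrite -es -sorted_pairwise; [apply: sort_sorted before_total _ | exact: before_trans].
rewrite pairwise_cat /= => /and3P [/allrelP s1o pw1 /andP [/allP os2 _]].
have ub x : x \in s1 -> o_write x -> o_reg x = o_reg o -> tsv_le (o_tsv x) (o_tsv o).
  move=> xs1 wx rx; apply: before_reads_from => //; first exact: s1s.
  by apply: s1o => //; apply: mem_head.
case: (read_source so wo) => [t0|[w sw [ww rw tw]]].
  (* A write to this register placed before [o] would have a pair at most [tsv0], against
     [write_gt0]; the register still holds [0]. *)
  rewrite t0 foldl_mem_step_none // => x xs1 wx rx.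
  by have := ub x xs1 wx rx; rewrite t0; apply/negP/write_gt0 => //; apply: s1s.
rewrite (foldl_mem_step _ (t := o_tsv o)) //; last first.
  exists w => //; move: (sw); rewrite -mems mem_cat inE => /or3P [//|/eqP we|/os2].
    by rewrite -we ww in wo.
  by rewrite (negbTE (write_before_read sw so rw ww wo _)) // tw tsv_le_refl.
apply: (sub_in_pairwise (P := mem s)) pw1; last by apply/allP => x /s1s.
move=> a b sa sb bef; apply/implyP => /and4P [wa wb /eqP ra /eqP rb].
by apply: before_reads_from => //; rewrite ra.
Qed.

End Linearization.

(** * Requests and replies in transit *)

Lemma fupd_eq T (f : nat -> T) i x : fupd f i x i = x.
Proof. by rewrite /fupd eqxx. Qed.

Lemma fupd_neq T (f : nat -> T) i x j : j != i -> fupd f i x j = f j.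
Proof. by rewrite /fupd => /negbTE ->. Qed.

Definition msg_rid (m : message) : nat :=
  match m with
  | MQuery _ rd _ | MResponse _ rd _ | MUpdate _ rd _ _ | MAck _ rd => rd
  end.

Definition is_request (m : message) : bool :=
  match m with MQuery _ _ _ | MUpdate _ _ _ _ => true | _ => false end.

(* A message from [src] to [dst] concerns request [rd] of [i] at server [q]
   if it is either that request or the reply to it. *)
Definition concerns (i : pid) (rd : nat) (q : pid) (src dst : pid) (m : message) : bool :=
  [&& msg_rid m == rd, (if is_request m then src else dst) == i
    & (if is_request m then dst else src) == q].

Definition pkt_concerns i rd q (p : packet) : bool :=
  concerns i rd q (pkt_src p) (pkt_dst p) (pkt_msg p).

Lemma mk_packets_ids k i out : map pkt_id (mk_packets k i out) = iota k (size out).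
Proof. by elim: out k => //= [[d m] t] IH k /=; rewrite IH. Qed.

Lemma mk_packets_mem k i out p : p \in mk_packets k i out ->
  pkt_src p = i /\ (pkt_dst p, pkt_msg p) \in out.
Proof.
elim: out k => //= [[d m] t] IH k; rewrite inE => /orP [/eqP -> /=|/IH [-> mem]].
  by rewrite mem_head.
by rewrite inE mem orbT.
Qed.

Lemma mk_packets_has k i out d m : (d, m) \in out ->
  exists2 p, p \in mk_packets k i out & [/\ pkt_src p = i, pkt_dst p = d & pkt_msg p = m].
Proof.
elim: out k => //= [[d' m'] t] IH k; rewrite inE => /orP [/eqP [-> ->]|/(IH k.+1) [p mem e]].
  by exists (Packet k i d' m'); rewrite ?mem_head.
by exists p => //; rewrite inE mem orbT.
Qed.

Lemma count_mk_packets k i out i' rd q :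
  count (pkt_concerns i' rd q) (mk_packets k i out) =
  count (fun x => concerns i' rd q i x.1 x.2) out.
Proof. by elim: out k => //= [[d m] t] IH k /=; rewrite IH. Qed.

Lemma count_bcast n m i i' rd q : is_request m -> q < n ->
  count (fun x => concerns i' rd q i x.1 x.2) (bcast n m) = ((msg_rid m == rd) && (i == i')).
Proof.
move=> req qn; rewrite /bcast count_map.
rewrite (@eq_count _ _ (fun j => (msg_rid m == rd) && (i == i') && (j == q))); last first.
  by move=> j /=; rewrite /concerns req andbA.
case: (_ && _) => /=; last by rewrite count_pred0.
by rewrite (count_uniq_mem _ (iota_uniq 0 n)) mem_iota qn.
Qed.

(** * Steps of the system and the count of messages per server *)

Definition update (c : config) (net : seq packet) (i : pid) (s : pstate)
    (out : seq (pid * message)) : config :=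
  Config (fupd (cst c) i s) (ccrashed c) (net ++ mk_packets (cnext c) i out)
         (cnext c + size out).

(** A delivery removes one packet up to permutation, the form suited to counting; [stepP] obtains it
    from the filters of [step] by uniqueness of packet identifiers. *)
Inductive step_spec (n : nat) (c : config) : label -> config -> option event -> Prop :=
| StepInvoke i op s out : i < n -> ~~ busy (cst c i) ->
    on_invoke n i (cst c i) op = (s, out) ->
    step_spec n c (LInvoke i op) (update c (cnet c) i s out) (Some (EvInv i op))
| StepDeliver p net s out res : perm_eq (cnet c) (p :: net) ->
    on_receive n (pkt_dst p) (cst c (pkt_dst p)) (pkt_src p) (pkt_msg p) = (s, out, res) ->
    step_spec n c (LDeliver (pkt_id p)) (update c net (pkt_dst p) s out)
      (omap (EvResp (pkt_dst p)) res)
| StepCrash i :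
    step_spec n c (LCrash i)
      (Config (cst c) (fupd (ccrashed c) i true) (cnet c) (cnext c)) None
| StepIdle : step_spec n c LIdle c None.

Lemma filter_id_perm (net : seq packet) k p t : uniq (map pkt_id net) ->
  [seq p <- net | pkt_id p == k] = p :: t ->
  pkt_id p = k /\ perm_eq net (p :: [seq q <- net | pkt_id q != k]).
Proof.
move=> un ef; have : p \in [seq p <- net | pkt_id p == k] by rewrite ef mem_head.
rewrite mem_filter => /andP [/eqP idp mem]; split=> //.
have sz : size [seq p <- net | pkt_id p == k] <= 1.
  by rewrite size_filter -(count_map pkt_id (pred1 k)) count_uniq_mem //; case: (_ \in _).
rewrite perm_sym -cat1s; have <- : [seq p <- net | pkt_id p == k] = [:: p].
  by move: sz; rewrite ef; case: t {ef}.
by rewrite (perm_filterC (fun q => pkt_id q == k)).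
Qed.

Lemma stepP n c l c' ev : uniq (map pkt_id (cnet c)) ->
  step n c l = Some (c', ev) -> step_spec n c l c' ev.
Proof.
move=> un; case: l => [i op|k|i|] /=.
- case: ifP => // /and3P [lin _ nb]; case ei: on_invoke => [s out] [<- <-].
  exact: (StepInvoke lin nb ei).
- case ef: [seq _ <- _ | _] => [//|p t].
  have [<- pm] := filter_id_perm un ef.
  case: ifP => // _; case er: on_receive => [[s out] res] [<- <-].
  exact: (StepDeliver pm er).
- by case: ifP => // _ [<- <-]; apply: StepCrash.
by case=> <- <-; apply: StepIdle.
Qed.

(** [net_count] is the central clause: for a busy client, request, reply in transit and recorded
    reply add up to one at each server; for an idle one, to zero. [net_rid] keeps fresh identifiers
    out of the network. *)
Record net_inv (n : nat) (c : config) : Prop := NetInv {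
  net_uniq : uniq (map pkt_id (cnet c));
  net_fresh : forall p, p \in cnet c -> pkt_id p < cnext c;
  net_pid : forall p, p \in cnet c -> pkt_src p < n /\ pkt_dst p < n;
  net_rid : forall p i rd q, p \in cnet c -> pkt_concerns i rd q p -> rd <= rid (cst c i);
  net_count : forall i q, q < n ->
    count (pkt_concerns i (rid (cst c i)) q) (cnet c)
      + count_mem q (map snd (responses (cst c i))) = busy (cst c i);
  net_resp_pid : forall i e, e \in responses (cst c i) -> e.2 < n;
  net_resp_size : forall i, size (responses (cst c i)) < quorum n }.

(** Common part of invocations and deliveries: the conditions concern only the process that moves,
    the remaining packets and the messages sent. *)
Lemma net_inv_update n c net i s out : net_inv n c -> i < n ->
  {subset net <= cnet c} -> uniq (map pkt_id net) ->
  (forall x, x \in out -> x.1 < n) ->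
  rid (cst c i) <= rid s ->
  (forall x i' rd q, x \in out -> concerns i' rd q i x.1 x.2 ->
     rd <= rid (fupd (cst c) i s i')) ->
  (forall i' q, q < n -> let s' := fupd (cst c) i s i' in
     count (pkt_concerns i' (rid s') q) net
     + count (fun x => concerns i' (rid s') q i x.1 x.2) out
     + count_mem q (map snd (responses s')) = busy s') ->
  (forall e, e \in responses s -> e.2 < n) -> size (responses s) < quorum n ->
  net_inv n (update c net i s out).
Proof.
move=> [un fr np nr nc nrp nrs] lin sub un' out_lt rid_le out_rid cnt rp rs.
split=> /=.
- rewrite map_cat cat_uniq un' mk_packets_ids iota_uniq andbT; apply/hasPn => k.
  rewrite mem_iota => /andP [lek _]; apply/negP => /mapP [p /sub /fr lt ek].
  by rewrite ek leqNgt lt in lek.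
- move=> p; rewrite mem_cat => /orP [/sub /fr|mem]; first exact: ltn_addr.
  have : pkt_id p \in map pkt_id (mk_packets (cnext c) i out) by apply: map_f.
  by rewrite mk_packets_ids mem_iota => /andP [].
- move=> p; rewrite mem_cat => /orP [/sub /np//|/mk_packets_mem [-> /out_lt]].
  by split.
- move=> p i' rd q; rewrite mem_cat => /orP [/sub mem /(nr _ _ _ _ mem) le|].
    by rewrite /fupd; case: eqP => // ei; rewrite ei in le; apply: leq_trans le rid_le.
  by case/mk_packets_mem => es mem; rewrite /pkt_concerns es; apply: out_rid mem.
- by move=> i' q qn; rewrite count_cat count_mk_packets cnt.
- by move=> i' e; rewrite /fupd; case: ifP => _; [apply: rp|apply: nrp].
by move=> i'; rewrite /fupd; case: ifP.
Qed.

Lemma net_resp_uniq n c i : net_inv n c -> uniq (map snd (responses (cst c i))).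
Proof.
move=> inv; apply: count_mem_uniq => q.
have [mem|/count_memPn //] := boolP (q \in _).
have qn : q < n by case/mapP: mem => e /(net_resp_pid inv) en ->.
have := net_count inv i qn; move: mem; rewrite -has_pred1 has_count.
by case: (busy _); lia.
Qed.

(** The packet itself uses up the single unit that [net_count] allows for its sender, so that sender
    cannot be recorded yet and the client is still busy. *)
Lemma net_recv_fresh n c p net x : net_inv n c -> perm_eq (cnet c) (p :: net) ->
  ~~ is_request (pkt_msg p) -> rid (cst c (pkt_dst p)) = msg_rid (pkt_msg p) ->
  busy (cst c (pkt_dst p)) /\
  add_resp (x, pkt_src p) (responses (cst c (pkt_dst p))) =
    (x, pkt_src p) :: responses (cst c (pkt_dst p)) /\
  pkt_src p \notin map snd (responses (cst c (pkt_dst p))).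
Proof.
move=> inv /permP pm /negbTE nreq erid.
have memp : p \in cnet c by rewrite -has_pred1 has_count pm /= eqxx.
have [sn _] := net_pid inv memp.
have := net_count inv (pkt_dst p) sn; rewrite pm /= {1}/pkt_concerns /concerns nreq erid !eqxx /=.
set m := count_mem _ _ => e; have m0 : m = 0 by case: (busy _) e; lia.
have nin : pkt_src p \notin map snd (responses (cst c (pkt_dst p))).
  by rewrite -has_pred1 has_count -/m m0.
split; first by case: (busy _) e.
split=> //; rewrite /add_resp; case: ifP => // mem.
by case/negP: nin; apply: (map_f snd mem).
Qed.

Lemma net_inv_step n c l c' ev : net_inv n c -> step n c l = Some (c', ev) -> net_inv n c'.
Proof.
move=> inv; case/(stepP (net_uniq inv)).
- move=> i op s out lin nb eo.
  have [m [req em]] : exists m, is_request m /\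
      [/\ out = bcast n m, msg_rid m = rid s, rid s = (rid (cst c i)).+1,
          busy s & responses s = responses (cst c i)].
    case: op eo => [r|r v] [<- <-]; first by eexists (MQuery _ _ _).
    by eexists (MUpdate _ _ _ _).
  case: em => -> er ers bs eres.
  have none q : q < n -> count_mem q (map snd (responses (cst c i))) = 0.
    by move=> qn; have := net_count inv i qn; rewrite (negbTE nb); lia.
  apply: net_inv_update => //.
  + exact: (net_uniq inv).
  + by move=> x /mapP [j]; rewrite mem_iota => /andP [_ lt] ->.
  + by rewrite ers leqnSn.
  + move=> x i' rd q /mapP [j _ ->]; rewrite /concerns req => /and3P [/eqP <- /eqP <- _].
    by rewrite fupd_eq er.
  + move=> i' q qn /=; rewrite count_bcast //.
    have [->|ne] := eqVneq i' i; last first.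
      by rewrite fupd_neq // andbF addn0 (net_count inv).
    rewrite fupd_eq er eqxx bs eres none // addn0.
    suff -> : count (pkt_concerns i (rid s) q) (cnet c) = 0 by [].
    (* By [net_rid] no packet in transit carries the new identifier. *)
    apply/eqP; rewrite -leqn0 leqNgt -has_count; apply/hasPn => p memp.
    by apply/negP => /(net_rid inv memp); rewrite ers ltnn.
  + by move=> e; rewrite eres; apply: (net_resp_pid inv).
  by rewrite eres; apply: (net_resp_size inv).
- move=> p net s out res pm er.
  have memp : p \in cnet c by rewrite (perm_mem pm) mem_head.
  have sub : {subset net <= cnet c} by move=> x xn; rewrite (perm_mem pm) inE xn orbT.
  have un : uniq (map pkt_id net).
    by have := net_uniq inv; rewrite (perm_uniq (perm_map _ pm)) => /andP [].
  have [sn dn] := net_pid inv memp.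
  have cnt (a : pred packet) : count a net = count a (cnet c) - a p by rewrite (permP pm) /= addKn.
  have cntp (a : pred packet) : a p -> 0 < count a (cnet c) by move=> ap; rewrite (permP pm) /= ap.
  (* A delivered request is replaced by its reply, which concerns the same request, so no count
     changes. *)
  have [req|nreq] := boolP (is_request (pkt_msg p)).
    have [m [nm [rm eout [rs bs ress]]]] : exists m, ~~ is_request m /\
       [/\ msg_rid m = msg_rid (pkt_msg p), out = [:: (pkt_src p, m)] &
       [/\ rid s = rid (cst c (pkt_dst p)), busy s = busy (cst c (pkt_dst p)) &
         responses s = responses (cst c (pkt_dst p))]].
      case: (pkt_msg p) req er => //= [l0 rd r|l0 rd r x] _ [<- <- _].
        by eexists (MResponse _ _ _).
      by eexists (MAck _ _).
    have same i' rd q : concerns i' rd q (pkt_dst p) (pkt_src p) m = pkt_concerns i' rd q p.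
      by rewrite /pkt_concerns /concerns req (negbTE nm) rm.
    have fs T (f : pstate -> T) i' : f s = f (cst c (pkt_dst p)) ->
        f (fupd (cst c) (pkt_dst p) s i') = f (cst c i').
      by rewrite /fupd; case: eqP => [->|].
    apply: net_inv_update => //.
    + by rewrite eout => x; rewrite inE => /eqP ->.
    + by rewrite rs ?leqnSn.
    + move=> x i' rd q; rewrite eout inE => /eqP -> /=; rewrite same fs //.
      exact: (net_rid inv memp).
    + move=> i' q qn /=; rewrite eout /= same !fs // addn0 -(net_count inv i' qn) cnt.
      by case e: (pkt_concerns _ _ _ _); rewrite ?subn0 ?addn0 // subnK // (cntp _ e).
    + by rewrite ress; apply: (net_resp_pid inv).
    by rewrite ress; apply: (net_resp_size inv).
  (* A reply whose identifier is not the current one is discarded, and no current request counted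
     it. *)
  have [erid|nrid] := eqVneq (rid (cst c (pkt_dst p))) (msg_rid (pkt_msg p)); last first.
    have [-> ->] : s = cst c (pkt_dst p) /\ out = [::].
      by case: (pkt_msg p) nreq nrid er => //= [l0 rd x|l0 rd] _ /negbTE -> [<- <- _].
    have fs i' : fupd (cst c) (pkt_dst p) (cst c (pkt_dst p)) i' = cst c i'.
      by rewrite /fupd; case: eqP => [->|].
    apply: net_inv_update => //.
    + move=> i' q qn /=; rewrite fs addn0 -(net_count inv i' qn) cnt.
      suff -> : pkt_concerns i' (rid (cst c i')) q p = false by rewrite subn0.
      rewrite /pkt_concerns /concerns (negbTE nreq); apply/negP => /and3P [/eqP e1 /eqP e2 _].
      by rewrite e1 e2 eqxx in nrid.
    + exact: (net_resp_pid inv).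
    exact: (net_resp_size inv).
  have cat i' q : pkt_concerns i' (rid (cst c i')) q p = (i' == pkt_dst p) && (pkt_src p == q).
    rewrite /pkt_concerns /concerns (negbTE nreq) [_ == i']eq_sym.
    by case: (eqVneq i') => [->|]; rewrite ?andbF ?erid ?eqxx.
  (* Responses and acks are treated together: completing a quorum opens a new identifier, with a
     broadcast if the operation continues; otherwise one unit moves from the network to the recorded
     replies. *)
  have [x ebs] : exists x, let resp := add_resp (x, pkt_src p) (responses (cst c (pkt_dst p))) in
      if size resp == quorum n then
        [/\ rid s = (rid (cst c (pkt_dst p))).+1, responses s = [::] &
            if busy s then exists2 m, is_request m /\ msg_rid m = rid s & out = bcast n m
            else out = [::]]
      else [/\ rid s = rid (cst c (pkt_dst p)), busy s = busy (cst c (pkt_dst p)),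
            responses s = resp & out = [::]].
    have [bt _] := net_recv_fresh None inv pm nreq erid.
    case: (pkt_msg p) nreq erid er => //= [l0 rd y|l0 rd] _ ->; rewrite eqxx.
      case: ifP => sz [<- <- _]; exists (Some y); rewrite /= sz //.
      by split=> //; rewrite bt; eexists (MUpdate _ _ _ _).
    by case: ifP => sz [<- <- _]; exists None; rewrite /= sz.
  have [bt [ea nin]] := net_recv_fresh x inv pm nreq erid.
  have sz := net_resp_size inv (pkt_dst p).
  have size0 : 0 < quorum n by [].
  move: ebs; rewrite /= ea /=; case: eqP => [_ [rs ress eout]|nq [rs bs ress ->]].
    apply: net_inv_update => //.
    + by case: (busy s) eout => [[m _ ->]|-> //] y /mapP [j]; rewrite mem_iota => /andP [_ lt] ->.
    + by rewrite rs ?leqnSn.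
    + case: (busy s) eout => [[m [req rm] ->]|-> //] y i' rd q /mapP [j _ ->].
      by rewrite /concerns req => /and3P [/eqP <- /eqP <- _]; rewrite fupd_eq rm.
    + move=> i' q qn /=; have [->|ne] := eqVneq i' (pkt_dst p); last first.
        rewrite fupd_neq // cnt cat (negbTE ne) subn0 -(net_count inv i' qn).
        case: (busy s) eout => [[m [req rm] ->]|-> //=]; last by lia.
        by rewrite count_bcast // [_ == i']eq_sym (negbTE ne) andbF addn0.
      rewrite fupd_eq ress addn0.
      have -> : count (pkt_concerns (pkt_dst p) (rid s) q) net = 0.
        apply/eqP; rewrite -leqn0 leqNgt -has_count; apply/hasPn => z /sub memz.
        by apply/negP => /(net_rid inv memz); rewrite rs ltnn.
      case: (busy s) eout => [[m [req rm] ->]|-> //=].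
      by rewrite count_bcast // rm !eqxx.
    + by rewrite ress.
    by rewrite ress.
  apply: net_inv_update => //.
  + by rewrite rs.
  + move=> i' q qn /=; have [->|ne] := eqVneq i' (pkt_dst p); last first.
      by rewrite fupd_neq // cnt cat (negbTE ne) subn0 -(net_count inv i' qn) addn0.
    rewrite fupd_eq rs bs ress -(net_count inv _ qn) cnt cat eqxx /= addn0.
    case: eqP => [e|_]; last by lia.
    have := cntp (pkt_concerns (pkt_dst p) (rid (cst c (pkt_dst p))) q).
    by rewrite cat eqxx e eqxx => /(_ isT); lia.
  + by move=> e; rewrite ress inE => /orP [/eqP -> //|]; apply: (net_resp_pid inv).
  by rewrite ress /= ltn_neqAle sz andbT; apply/eqP.
- by move=> i; case: inv.
by case: inv.
Qed.

(** * History variables *)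

(* A request sent by a process on behalf of operation [q_op], invoked at clock
   [q_inv]: a query if [q_tsv] is [None], an update with pair [x] if it is [Some x]. *)
Record req := Req { q_op : operation; q_inv : nat; q_tsv : option tsv }.

(* History variables of one process: its requests by identifier, the updates it
   applied and the queries it answered (clock, register, pair), and its
   completed operations. *)
Record ghost := Ghost {
  reqs : nat -> option req;
  ulog : seq (nat * reg * tsv);
  qlog : seq (nat * reg * tsv);
  ops : seq oprec }.

Definition ghost_init : ghost := Ghost (fun _ => None) [::] [::] [::].

(** [ops] is left out: what other processes and packets rely on involves only requests and logs. *)
Definition ghost_le (g g' : ghost) : Prop :=
  [/\ forall rd q, reqs g rd = Some q -> reqs g' rd = Some q,
      {subset ulog g <= ulog g'} & {subset qlog g <= qlog g'}].

Definition ghosts_le (G G' : pid -> ghost) : Prop := forall i, ghost_le (G i) (G' i).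

Lemma ghost_le_refl g : ghost_le g g.
Proof. by split. Qed.

Lemma ghosts_le_refl G : ghosts_le G G.
Proof. by move=> i; apply: ghost_le_refl. Qed.

Lemma ghosts_le_fupd G i g : ghost_le (G i) g -> ghosts_le G (fupd G i g).
Proof. by move=> le j; rewrite /fupd; case: eqP => [->|_] //; apply: ghost_le_refl. Qed.

(** The write may still be pending: its request is recorded at invocation, and its pair can be read
    before it responds. *)
Definition written (G : pid -> ghost) (r : reg) (x : tsv) : Prop :=
  x = tsv0 \/ exists i rd a v, reqs (G i) rd = Some (Req (OpWrite r v) a (Some x)).

Definition has_quorum (n : nat) (P : pid -> Prop) : Prop :=
  exists qs, [/\ uniq qs, all (gtn n) qs, size qs = quorum n & forall q, q \in qs -> P q].

Definition read_quorum n (G : pid -> ghost) r a x : Prop :=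
  has_quorum n (fun q => exists t y, [/\ a < t, tsv_le y x & (t, r, y) \in qlog (G q)]).

Definition write_quorum n (G : pid -> ghost) r x b : Prop :=
  has_quorum n (fun q => exists t, t < b /\ (t, r, x) \in ulog (G q)).

(** The clause [0 < q_inv q] later makes the pair of a write strictly larger than [tsv0]. *)
Definition req_ok n (G : pid -> ghost) (i : pid) (q : req) : Prop :=
  match q_tsv q with
  | None => ~~ is_write (q_op q)
  | Some x =>
      written G (op_reg (q_op q)) x /\
      match q_op q with
      | OpRead r => read_quorum n G r (q_inv q) x
      | OpWrite r v => x = ((q_inv q, i), v) /\ 0 < q_inv q
      end
  end.

Record op_ok n (G : pid -> ghost) (i : pid) (o : oprec) : Prop := OpOk {
  op_pid : o_pid o = i;
  op_inv_resp : o_inv o <= o_resp o;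
  op_tsv_resp : (o_tsv o).1.1 < o_resp o;
  op_req : req_ok n G i (Req (o_op o) (o_inv o) (Some (o_tsv o)));
  op_acks : write_quorum n G (o_reg o) (o_tsv o) (o_resp o) }.

Definition resp_ok (G : pid -> ghost) (clock : nat) (q : req) (e : option tsv * pid) : Prop :=
  match q_tsv q with
  | None => exists t y, [/\ e.1 = Some y, q_inv q < t, t <= clock
                          & (t, op_reg (q_op q), y) \in qlog (G e.2)]
  | Some x => exists t, [/\ e.1 = None, t <= clock
                          & (t, op_reg (q_op q), x) \in ulog (G e.2)]
  end.

Record current_ok (G : pid -> ghost) (i : pid) (s : pstate) (q : req) : Prop := CurrentOk {
  cur_inv : q_inv q <= clk s;
  cur_reading : reading s = ~~ is_write (q_op q);
  cur_ops : forall o, o \in ops (G i) -> o_resp o < q_inv q;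
  cur_reg : q_tsv q = None -> rreg s = op_reg (q_op q);
  cur_val : forall x, q_tsv q = Some x -> x.1.1 <= clk s /\ (reading s -> rval s = x.2);
  cur_resp : forall e, e \in responses s -> resp_ok G (clk s) q e }.

(** A reply refers to a log entry of the server whose clock is at most that of the message, so the
    clock of a client that accepts it passes that entry. *)
Definition pkt_ok (G : pid -> ghost) (src dst : pid) (m : message) : Prop :=
  match m with
  | MQuery l rd r => exists op a,
      [/\ reqs (G src) rd = Some (Req op a None), op_reg op = r & a <= l]
  | MResponse l rd y => exists op a t,
      [/\ reqs (G dst) rd = Some (Req op a None), a < t, t <= l
        & (t, op_reg op, y) \in qlog (G src)]
  | MUpdate l rd r x => exists op a,
      [/\ reqs (G src) rd = Some (Req op a (Some x)), op_reg op = r & x.1.1 <= l]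
  | MAck l rd => exists op a x t,
      [/\ reqs (G dst) rd = Some (Req op a (Some x)), t <= l
        & (t, op_reg op, x) \in ulog (G src)]
  end.

(** [loc_log] links the order of clocks at a server to the order of pairs. [loc_write] will turn the
    source of a read into a completed operation, and [loc_hist] ties the history to the records,
    with at most one pending invocation. *)
Record local_inv n (G : pid -> ghost) (i : pid) (s : pstate) (h : seq event) : Prop := LocalInv {
  loc_rid : forall rd q, reqs (G i) rd = Some q -> rd <= rid s;
  loc_req : forall rd q, reqs (G i) rd = Some q -> req_ok n G i q;
  loc_busy : busy s = isSome (reqs (G i) (rid s));
  loc_ulog : forall t r x, (t, r, x) \in ulog (G i) -> t <= clk s /\ tsv_le x (tvps s r);
  loc_qlog : forall t r y, (t, r, y) \in qlog (G i) ->
    [/\ t <= clk s, y.1.1 <= t & written G r y];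
  loc_log : forall t r x t' y, (t, r, x) \in ulog (G i) -> (t', r, y) \in qlog (G i) ->
    t < t' -> tsv_le x y;
  loc_tvps : forall r, written G r (tvps s r) /\ (tvps s r).1.1 <= clk s;
  loc_cur : forall q, reqs (G i) (rid s) = Some q -> current_ok G i s q;
  loc_ops : forall o, o \in ops (G i) -> [/\ i < n, op_ok n G i o & o_resp o <= clk s];
  loc_sorted : sorted (fun a b => o_resp a < o_inv b) (ops (G i));
  loc_write : forall rd r v a x, reqs (G i) rd = Some (Req (OpWrite r v) a (Some x)) ->
    rd = rid s \/ exists2 o, o \in ops (G i) & o_op o = OpWrite r v /\ o_tsv o = x;
  loc_hist : h = events (ops (G i)) ++
    (if reqs (G i) (rid s) is Some q then [:: EvInv i (q_op q)] else [::]) }.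

Record sys_inv n (G : pid -> ghost) (c : config) (H : seq event) : Prop := SysInv {
  inv_net : net_inv n c;
  inv_local : forall i, local_inv n G i (cst c i) (proj i H);
  inv_pkt : forall p, p \in cnet c -> pkt_ok G (pkt_src p) (pkt_dst p) (pkt_msg p) }.

(** * Monotonicity in the history variables *)

Section Monotonicity.
Variables (n : nat) (G G' : pid -> ghost).
Hypothesis GG' : ghosts_le G G'.

Lemma reqs_mono i rd q : reqs (G i) rd = Some q -> reqs (G' i) rd = Some q.
Proof. by have [h _ _] := GG' i; apply: h. Qed.

Lemma ulog_mono i e : e \in ulog (G i) -> e \in ulog (G' i).
Proof. by have [_ h _] := GG' i; apply: h. Qed.

Lemma qlog_mono i e : e \in qlog (G i) -> e \in qlog (G' i).
Proof. by have [_ _ h] := GG' i; apply: h. Qed.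

Lemma written_mono r x : written G r x -> written G' r x.
Proof.
by case=> [->|[i [rd [a [v /reqs_mono e]]]]]; [left|right; exists i, rd, a, v].
Qed.

Lemma read_quorum_mono r a x : read_quorum n G r a x -> read_quorum n G' r a x.
Proof.
case=> qs [u lt sz h]; exists qs; split=> // q /h [t [y [? ? /qlog_mono ?]]].
by exists t, y.
Qed.

Lemma write_quorum_mono r x b : write_quorum n G r x b -> write_quorum n G' r x b.
Proof.
by case=> qs [u lt sz h]; exists qs; split=> // q /h [t [? /ulog_mono ?]]; exists t.
Qed.

Lemma req_ok_mono i q : req_ok n G i q -> req_ok n G' i q.
Proof.
rewrite /req_ok; case: q_tsv => // x [/written_mono w h]; split=> //.
by case: (q_op q) h => // r; apply: read_quorum_mono.
Qed.

Lemma op_ok_mono i o : op_ok n G i o -> op_ok n G' i o.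
Proof. by case=> *; split=> //; [apply: req_ok_mono | apply: write_quorum_mono]. Qed.

Lemma resp_ok_mono b b' q e : b <= b' -> resp_ok G b q e -> resp_ok G' b' q e.
Proof.
move=> le; rewrite /resp_ok; case: q_tsv => [x [t [e1 tb /ulog_mono l]]|[t [y [e1 at' tb /qlog_mono l]]]].
  by exists t; rewrite (leq_trans tb le).
by exists t, y; rewrite (leq_trans tb le).
Qed.

Lemma current_ok_mono i s s' q : ops (G' i) = ops (G i) -> clk s <= clk s' ->
  reading s' = reading s -> rreg s' = rreg s -> rval s' = rval s ->
  (forall e, e \in responses s' -> e \in responses s \/ resp_ok G (clk s') q e) ->
  current_ok G i s q -> current_ok G' i s' q.
Proof.
move=> eo le er erg erv resp [h1 h2 h3 h4 h5 h6]; split.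
- exact: leq_trans h1 le.
- by rewrite er.
- by rewrite eo.
- by rewrite erg.
- by move=> x /h5 [xs v]; rewrite er erv (leq_trans xs le).
by move=> e /resp [/h6|]; apply: resp_ok_mono.
Qed.

Lemma pkt_ok_mono src dst m : pkt_ok G src dst m -> pkt_ok G' src dst m.
Proof.
case: m => [l rd r|l rd y|l rd r x|l rd] /=.
- by case=> op [a [/reqs_mono ? ? ?]]; exists op, a.
- by case=> op [a [t [/reqs_mono ? ? ? /qlog_mono ?]]]; exists op, a, t.
- by case=> op [a [/reqs_mono ? ? ?]]; exists op, a.
by case=> op [a [x [t [/reqs_mono ? ? /ulog_mono ?]]]]; exists op, a, x, t.
Qed.

Lemma local_inv_mono i s h : G' i = G i -> local_inv n G i s h -> local_inv n G' i s h.
Proof.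
move=> ei [h1 h2 h3 h4 h5 h6 h7 h8 h9 h10 h11 h12].
split; rewrite ?ei //.
- by move=> rd q /h2; apply: req_ok_mono.
- by move=> t r y /h5 [? ? /written_mono].
- by move=> r; have [/written_mono] := h7 r.
- by move=> q /h8; apply: current_ok_mono; rewrite ?ei // => e; left.
by move=> o /h9 [? /op_ok_mono].
Qed.

End Monotonicity.

Lemma inv_init n : sys_inv n (fun _ => ghost_init) init_config [::].
Proof.
by split=> // i; split=> //= r; split=> //; left.
Qed.

(** Only the history variables of [i] grow, so other processes and packets already in transit keep
    their invariants by monotonicity. *)
Lemma inv_update n G c H net i s out g ev : sys_inv n G c H ->
  ghost_le (G i) g -> {subset net <= cnet c} -> net_inv n (update c net i s out) ->
  (if ev is Some e then ev_pid e = i else True) ->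
  local_inv n (fupd G i g) i s (proj i H ++ oapp (cons^~ [::]) [::] ev) ->
  (forall x, x \in out -> pkt_ok (fupd G i g) i x.1 x.2) ->
  sys_inv n (fupd G i g) (update c net i s out) (H ++ oapp (cons^~ [::]) [::] ev).
Proof.
move=> [_ loc pk] le sub ni evi li po; have GG := ghosts_le_fupd le.
split=> //= [j|p].
  rewrite /proj filter_cat -/(proj j H); have [->|ne] := eqVneq j i.
    by rewrite fupd_eq; case: ev evi li => //= e ->; rewrite eqxx.
  rewrite fupd_neq //.
  have -> : [seq e <- oapp (cons^~ [::]) [::] ev | ev_pid e == j] = [::].
    by case: ev evi {li} => //= e ->; rewrite eq_sym (negbTE ne).
  by rewrite cats0; apply: local_inv_mono (loc j); rewrite ?fupd_neq.
rewrite mem_cat => /orP [/sub /pk|/mk_packets_mem [-> /po //]].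
exact: pkt_ok_mono.
Qed.

(** * Preservation of the local invariant by each handler *)

Definition good_step n (G : pid -> ghost) i (g : ghost) (s : pstate)
    (h : seq event) (out : seq (pid * message)) : Prop :=
  [/\ ghost_le (G i) g, local_inv n (fupd G i g) i s h
    & forall x, x \in out -> pkt_ok (fupd G i g) i x.1 x.2].

Definition add_req (g : ghost) rd q : ghost :=
  Ghost (fupd (reqs g) rd (Some q)) (ulog g) (qlog g) (ops g).

Lemma add_req_le g rd q : reqs g rd = None -> ghost_le g (add_req g rd q).
Proof.
move=> e; split=> //= rd' q'; rewrite /fupd.
by case: eqP => [->|//]; rewrite e.
Qed.

Lemma loc_rid_fresh n G i s h : local_inv n G i s h -> reqs (G i) (rid s).+1 = None.
Proof.
move=> L; case e: (reqs _ _) => [q|//].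
by have := loc_rid L e; rewrite ltnn.
Qed.

Lemma invoke_step n G i s h op s' out : local_inv n G i s h ->
  ~~ busy s -> responses s = [::] -> on_invoke n i s op = (s', out) ->
  exists g, good_step n G i g s' (h ++ [:: EvInv i op]) out.
Proof.
move=> L nb re eo.
(* Reads and writes are put in one form, so that the invariant is checked once. *)
have [es eout] : s' = PState (clk s).+1 (rid s).+1 (tvps s) [::] (~~ is_write op)
    (if op is OpRead r then r else rreg s) (rval s) true /\
    out = bcast n (match op with OpRead r => MQuery (clk s).+1 (rid s).+1 r
       | OpWrite r v => MUpdate (clk s).+1 (rid s).+1 r (((clk s).+1, i), v) end).
  by rewrite -re; case: op eo => [r|r v] [<- <-].
have [q eq] : exists q, q = Req op (clk s).+1
    (if op is OpWrite _ v then Some (((clk s).+1, i), v) else None) by eexists.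
have none : reqs (G i) (rid s) = None by have := loc_busy L; rewrite (negbTE nb); case: reqs.
set g := add_req (G i) (rid s).+1 q; exists g.
have le : ghost_le (G i) g by apply: add_req_le; apply: loc_rid_fresh L.
have GG := ghosts_le_fupd le; rewrite /good_step; set G' := fupd G i g in GG *.
have eG : G' i = g by apply: fupd_eq.
have eR rd q' : reqs g rd = Some q' ->
    rd = (rid s).+1 /\ q' = q \/ reqs (G i) rd = Some q'.
  by rewrite /g /= /fupd; case: eqP => [-> [<-]|_]; [left|right].
have eq1 : reqs (G' i) (rid s).+1 = Some q by rewrite eG /= fupd_eq.
split=> //; last first.
  rewrite eout => x /mapP [j _ ->] /=; rewrite eq in eq1.
  by case: (op) eq1 => [r|r v] eq1; [exists (OpRead r)|exists (OpWrite r v)]; exists (clk s).+1.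
rewrite es; split=> /=; rewrite ?eq1 ?eG //.
- by move=> rd q' /eR [[-> _] //|/(loc_rid L) /leqW].
- move=> rd q' /eR [[_ ->]|/(loc_req L)]; last exact: req_ok_mono.
  move: eq1; rewrite /req_ok eq; case: (op) => [r|r v] //= eq1; split=> //.
  by right; exists i, (rid s).+1, (clk s).+1, v.
- by move=> t r x /(loc_ulog L) [/leqW].
- by move=> t r y /(loc_qlog L) [/leqW ? ? /(written_mono GG)].
- exact: loc_log L.
- by move=> r; have [/(written_mono GG) ? /leqW] := loc_tvps L r.
- move=> q' [<-]; rewrite eq; split=> //=.
  + by rewrite eG => o /(loc_ops L) [].
  + by case: (op).
  by case: (op) => //= r v _ [<-].
- by move=> o /(loc_ops L) [? /(op_ok_mono GG) ? /leqW].
- exact: loc_sorted L.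
- move=> rd r v a x /eR [[-> _]|e]; first by left.
  have [rde|] := loc_write L e; last by right.
  by rewrite rde none in e.
by rewrite (loc_hist L) none cats0 eq.
Qed.

(** By [loc_ulog] the pair sent dominates every update applied so far, which is [loc_log] for the
    new entry. *)
Lemma query_step n G i s h j l' rd' r : local_inv n G i s h -> pkt_ok G j i (MQuery l' rd' r) ->
  let: (s', out, _) := on_receive n i s j (MQuery l' rd' r) in
  exists g, good_step n G i g s' h out.
Proof.
move=> L [op [a [ej er al]]] /=; set l := (maxn _ _).+1.
set g := Ghost (reqs (G i)) (ulog (G i)) ((l, r, tvps s r) :: qlog (G i)) (ops (G i)).
exists g.
have le : ghost_le (G i) g by split=> //= x xq; rewrite inE xq orbT.
have GG := ghosts_le_fupd le; rewrite /good_step; set G' := fupd G i g in GG *.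
have eG : G' i = g by apply: fupd_eq.
have kl : clk s < l by rewrite ltnS leq_maxl.
have kl' := ltnW kl.
split=> //; last first.
  move=> x; rewrite inE => /eqP -> /=; exists op, a, l.
  rewrite (reqs_mono GG ej) eG /= er mem_head; split=> //.
  by rewrite ltnS leq_max al orbT.
split=> /=; rewrite ?eG //.
- exact: loc_rid L.
- by move=> rd q /(loc_req L); apply: req_ok_mono.
- exact: loc_busy L.
- by move=> t r' x /(loc_ulog L) [tk ?]; rewrite (leq_trans tk kl').
- move=> t r' y; rewrite inE => /orP [/eqP [-> -> ->]|/(loc_qlog L) [tk ? /(written_mono GG)]].
    by have [/(written_mono GG) ? yk] := loc_tvps L r; rewrite (leq_trans yk kl').
  by rewrite (leq_trans tk kl').
- move=> t r' x t' y xu; rewrite inE => /orP [/eqP [_ e ->] _|/(loc_log L xu)//].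
  by have [_] := loc_ulog L xu; rewrite e.
- by move=> r'; have [/(written_mono GG) ? yk] := loc_tvps L r'; rewrite (leq_trans yk kl').
- by move=> q /(loc_cur L); apply: (current_ok_mono GG) => //; [rewrite eG|move=> e; left].
- by move=> o /(loc_ops L) [? /(op_ok_mono GG) ? ok]; rewrite (leq_trans ok kl').
- exact: loc_sorted L.
- exact: loc_write L.
exact: loc_hist L.
Qed.

(** The new update has a clock above all logged queries, so [loc_log] asks nothing new. The
    invariant of the sender shows that the pair was written. *)
Lemma update_step n G i s h j l' rd' r x hj sj : local_inv n G i s h -> local_inv n G j sj hj ->
  pkt_ok G j i (MUpdate l' rd' r x) ->
  let: (s', out, _) := on_receive n i s j (MUpdate l' rd' r x) in
  exists g, good_step n G i g s' h out.
Proof.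
move=> L Lj [op [a [ej er al]]] /=; set l := (maxn _ _).+1.
set g := Ghost (reqs (G i)) ((l, r, x) :: ulog (G i)) (qlog (G i)) (ops (G i)).
exists g.
have le : ghost_le (G i) g by split=> //= z zu; rewrite inE zu orbT.
have GG := ghosts_le_fupd le; rewrite /good_step; set G' := fupd G i g in GG *.
have eG : G' i = g by apply: fupd_eq.
have kl : clk s < l by rewrite ltnS leq_maxl.
have kl' := ltnW kl.
have xl : x.1.1 <= l by rewrite (leq_trans al) // ltnW // ltnS leq_maxr.
have wx : written G r x by have := loc_req Lj ej; rewrite /req_ok /= er => -[].
have tv r' : tsv_le (tvps s r') (fupd (tvps s) r (tsv_max (tvps s r) x) r').
  by rewrite /fupd; case: eqP => [->|_]; [apply: tsv_le_maxl|apply: tsv_le_refl].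
split=> //; last first.
  move=> z; rewrite inE => /eqP -> /=; exists op, a, x, l.
  by rewrite (reqs_mono GG ej) eG /= er mem_head.
split=> /=; rewrite ?eG //.
- exact: loc_rid L.
- by move=> rd q /(loc_req L); apply: req_ok_mono.
- exact: loc_busy L.
- move=> t r' y; rewrite inE => /orP [/eqP [-> -> ->]|/(loc_ulog L) [tk yk]].
    by rewrite leqnn fupd_eq; split=> //; apply: tsv_le_maxr.
  by rewrite (leq_trans tk kl'); split=> //; apply: tsv_le_trans yk _.
- by move=> t r' y /(loc_qlog L) [tk ? /(written_mono GG)]; rewrite (leq_trans tk kl').
- move=> t r' y t' z; rewrite inE => /orP [/eqP [-> _ _]|yu /(loc_log L yu)//].
  by move=> /(loc_qlog L) [tk _ _] lt; have := leq_trans kl (ltnW (leq_trans lt tk)); rewrite ltnn.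
- move=> r'; have [/(written_mono GG) w yk] := loc_tvps L r'.
  rewrite /fupd; case: eqP => [e|_]; last by rewrite (leq_trans yk kl').
  apply: (tsv_maxP (P := fun z => written G' r' z /\ z.1.1 <= l)); rewrite ?e -?e.
    by rewrite (leq_trans yk kl').
  by split=> //; rewrite e; apply: written_mono wx.
- by move=> q /(loc_cur L); apply: (current_ok_mono GG) => //; [rewrite eG|move=> e; left].
- by move=> o /(loc_ops L) [? /(op_ok_mono GG) ? ok]; rewrite (leq_trans ok kl').
- exact: loc_sorted L.
- exact: loc_write L.
exact: loc_hist L.
Qed.

(** Serves replies that do not complete a quorum. *)
Lemma local_inv_clk n G i s s' h : local_inv n G i s h -> clk s <= clk s' ->
  rid s' = rid s -> tvps s' = tvps s -> reading s' = reading s -> rreg s' = rreg s ->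
  rval s' = rval s -> busy s' = busy s ->
  (forall q e, reqs (G i) (rid s) = Some q -> e \in responses s' ->
     e \in responses s \/ resp_ok G (clk s') q e) ->
  local_inv n G i s' h.
Proof.
move=> L le er et erd erg erv eb resp; split; rewrite ?er ?et ?eb.
- exact: loc_rid L.
- exact: loc_req L.
- exact: loc_busy L.
- by move=> t r x /(loc_ulog L) [/leq_trans -> //].
- by move=> t r x /(loc_qlog L) [/leq_trans -> //].
- exact: loc_log L.
- by move=> r; have [? /leq_trans -> //] := loc_tvps L r.
- move=> q eq; have := loc_cur L eq; apply: (current_ok_mono (ghosts_le_refl G)) => //.
  by move=> e; apply: resp.
- by move=> o /(loc_ops L) [? ? /leq_trans -> //].
- exact: loc_sorted L.
- exact: loc_write L.
exact: loc_hist L.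
Qed.

Lemma good_step_idle n G i s h : local_inv n G i s h -> good_step n G i (G i) s h [::].
Proof.
move=> L; have le := ghost_le_refl (G i); split=> //.
by apply: (local_inv_mono (ghosts_le_fupd le)) L; rewrite fupd_eq.
Qed.

Lemma add_resp_mem x e s : e \in add_resp x s -> e = x \/ e \in s.
Proof. by rewrite /add_resp; case: ifP => _; [right|rewrite inE => /orP [/eqP|]; auto]. Qed.

Lemma reply_quorum n (P : pid -> Prop) (resp : seq (option tsv * pid)) :
  uniq (map snd resp) -> (forall e, e \in resp -> e.2 < n) -> size resp = quorum n ->
  (forall e, e \in resp -> P e.2) -> has_quorum n P.
Proof.
move=> un lt sz h; exists (map snd resp); rewrite size_map; split=> //.
  by apply/allP => q /mapP [e /lt ltn ->].
by move=> q /mapP [e /h Pe ->].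
Qed.

Section Replies.
Variables (n : nat) (G : pid -> ghost) (i : pid) (s : pstate) (h : seq event) (j : pid).
Hypothesis loc : forall k, exists sk hk, local_inv n G k sk hk.
Hypothesis L : local_inv n G i s h.

Lemma response_step l' y :
  let m := MResponse l' (rid s) y in
  let resp := add_resp (Some y, j) (responses s) in
  uniq (map snd resp) -> (forall e, e \in resp -> e.2 < n) -> pkt_ok G j i m ->
  let: (s', out, res) := on_receive n i s j m in
  exists g, good_step n G i g s' (h ++ oapp (fun r => [:: EvResp i r]) [::] res) out.
Proof.
move=> m resp un lt [op [a [t [eq at' tl yl]]]] /=; rewrite eqxx -/resp.
set l := (maxn _ _).+1.
have kl : clk s <= l by rewrite ltnW // ltnS leq_maxl.
have C := loc_cur L eq.
have rok e : e \in resp -> resp_ok G l (Req op a None) e.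
  case/add_resp_mem => [->|/(cur_resp C)]; last exact: (resp_ok_mono (ghosts_le_refl G) kl).
  by exists t, y; split=> //; rewrite (leq_trans tl) // ltnW // ltnS leq_maxr.
case: eqP => [sz|_]; last first.
  exists (G i) => /=; rewrite cats0; apply: good_step_idle; apply: (local_inv_clk L) => //=.
  by move=> q e; rewrite eq => -[<-] /rok; right.
rewrite /= cats0; set x := max_tsv _.
(* A quorum is nonempty, so the maximum is a pair actually received and not the default of
   [max_tsv]. *)
have xmem : exists2 e, e \in resp & e.1 = Some x.
  have : x \in pmap (fun e : option tsv * pid => e.1) resp.
    apply: max_tsv_mem; case: (resp) sz rok => // e r _ /(_ e (mem_head _ _)).
    by case=> t' [y' [/= -> _ _ _]].
  by rewrite mem_pmap => /mapP [e er ->]; exists e.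
have [xl xw] : x.1.1 <= l /\ written G (op_reg op) x.
  have [e /rok [t' [y' [-> _ tl' yq]]] [<-]] := xmem.
  have [sk [hk Lk]] := loc e.2; have [_ yt ?] := loc_qlog Lk yq.
  by rewrite (leq_trans yt tl').
have rd : ~~ is_write op by have := loc_req L eq.
have quo : read_quorum n G (op_reg op) a x.
  apply: (reply_quorum un lt sz) => e er; have [t' [y' [ey ? _ ?]]] := rok e er.
  exists t', y'; split=> //; apply: max_tsv_ge; rewrite mem_pmap -ey.
  exact: (map_f (fun e : option tsv * pid => e.1)).
(* The update phase of the read is a new request that keeps the operation and its invocation
   clock. *)
set q := Req op a (Some x); set g := add_req (G i) (rid s).+1 q; exists g.
have le : ghost_le (G i) g by apply: add_req_le; apply: loc_rid_fresh L.
have GG := ghosts_le_fupd le; rewrite /good_step; set G' := fupd G i g in GG *.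
have eG : G' i = g by apply: fupd_eq.
have eR rd' q' : reqs g rd' = Some q' ->
    rd' = (rid s).+1 /\ q' = q \/ reqs (G i) rd' = Some q'.
  by rewrite /g /= /fupd; case: eqP => [-> [<-]|_]; [left|right].
have eq1 : reqs (G' i) (rid s).+1 = Some q by rewrite eG /= fupd_eq.
split=> //; last first.
  by move=> z /mapP [k _ ->] /=; exists op, a; rewrite (cur_reg C).
split=> /=; rewrite ?eq1 ?eG //.
- by move=> rd' q' /eR [[-> _] //|/(loc_rid L) /leqW].
- move=> rd' q' /eR [[_ ->]|/(loc_req L)]; last exact: req_ok_mono.
  rewrite /req_ok /=; split; first exact: written_mono xw.
  by case: (op) rd quo => // r _; apply: read_quorum_mono.
- by rewrite (loc_busy L) eq.
- by move=> t' r z /(loc_ulog L) [/leq_trans ->].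
- by move=> t' r z /(loc_qlog L) [/leq_trans -> // ? /(written_mono GG)].
- exact: loc_log L.
- by move=> r; have [/(written_mono GG) ? /leq_trans ->] := loc_tvps L r.
- move=> q' [<-]; split=> //=.
  + exact: leq_trans (cur_inv C) kl.
  + exact: cur_reading C.
  + by rewrite eG; apply: cur_ops C.
  by move=> _ [<-].
- by move=> o /(loc_ops L) [? /(op_ok_mono GG) ? /leq_trans ->].
- exact: loc_sorted L.
- move=> rd' r v b z /eR [[-> _]|e]; first by left.
  have [rde|] := loc_write L e; last by right.
  by rewrite rde eq in e.
by rewrite (loc_hist L) eq.
Qed.

Lemma ack_step l' :
  let m := MAck l' (rid s) in
  let resp := add_resp (None, j) (responses s) in
  i < n -> uniq (map snd resp) -> (forall e, e \in resp -> e.2 < n) -> pkt_ok G j i m ->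
  let: (s', out, res) := on_receive n i s j m in
  exists g, good_step n G i g s' (h ++ oapp (fun r => [:: EvResp i r]) [::] res) out.
Proof.
move=> m resp lin un lt [op [a [x [t [eq tl xl]]]]] /=; rewrite eqxx -/resp.
set l := (maxn _ _).+1.
have kl : clk s < l by rewrite ltnS leq_maxl.
have kl' := ltnW kl.
have C := loc_cur L eq.
(* The bound is [l.-1], that is [maxn (clk s) l'], because [write_quorum] needs acknowledgement
   clocks strictly below the response clock [l]. *)
have rok e : e \in resp -> resp_ok G l.-1 (Req op a (Some x)) e.
  case/add_resp_mem => [->|/(cur_resp C)]; last first.
    by apply: (resp_ok_mono (ghosts_le_refl G)); apply: leq_maxl.
  by exists t; split=> //=; rewrite (leq_trans tl) // leq_maxr.
case: eqP => [sz|_]; last first.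
  exists (G i) => /=; rewrite cats0; apply: good_step_idle; apply: (local_inv_clk L) => //=.
  move=> q e; rewrite eq => -[<-] /rok re; right.
  exact: (resp_ok_mono (ghosts_le_refl G) (leq_pred l)).
rewrite /=.
have quo : write_quorum n G (op_reg op) x l.
  apply: (reply_quorum un lt sz) => e er; have [t' [_ ? ?]] := rok e er.
  by exists t'.
have [xk xv] := cur_val C erefl.
set o := OpRec i op a l x.
set g := Ghost (reqs (G i)) (ulog (G i)) (qlog (G i)) (rcons (ops (G i)) o); exists g.
have le : ghost_le (G i) g by split.
have GG := ghosts_le_fupd le; rewrite /good_step; set G' := fupd G i g in GG *.
have eG : G' i = g by apply: fupd_eq.
have al : a < l by apply: leq_ltn_trans (cur_inv C) kl.
split=> //; split=> /=; rewrite ?eG //= ?(loc_rid_fresh L) //.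
- by move=> rd q /(loc_rid L) /leqW.
- by move=> rd q /(loc_req L); apply: req_ok_mono.
- by move=> t' r z /(loc_ulog L) [/leq_trans ->].
- by move=> t' r z /(loc_qlog L) [/leq_trans -> // ? /(written_mono GG)].
- exact: loc_log L.
- by move=> r; have [/(written_mono GG) ? /leq_trans ->] := loc_tvps L r.
- move=> o'; rewrite mem_rcons inE => /orP [/eqP ->|/(loc_ops L) [? /(op_ok_mono GG) ? /leq_trans -> //]].
  split=> //; apply: (op_ok_mono GG); split=> //=; first exact: ltnW.
    exact: leq_ltn_trans xk kl.
  exact: (loc_req L eq).
(* By [cur_ops] all earlier operations responded before this one was invoked. *)
- have := loc_sorted L; have := cur_ops C.
  case: (ops (G i)) => //= o1 os lto; rewrite rcons_path => -> /=.
  by apply: lto; apply: mem_last.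
(* A write pending under the current identifier is the one that [o] completes. *)
- move=> rd r v b z e; right; have [rde|[o' os eo]] := loc_write L e.
    by move: e; rewrite rde eq => -[eop _ ex]; exists o; rewrite ?mem_rcons ?mem_head /o /= ?eop ?ex.
  by exists o' => //; rewrite mem_rcons inE os orbT.
rewrite (loc_hist L) eq /= events_rcons cats0 -catA /= /o_events /o_res /o_write /=.
have := cur_reading C; rewrite /= => rdE; rewrite rdE; congr (_ ++ [:: _; EvResp _ _]).
by case: (is_write op) rdE xv => //= -> ->.
Qed.

End Replies.

(** The growth of [G] is kept in the conclusion because termination reuses requests recorded
    earlier. *)
Lemma inv_step n G c H l c' ev : sys_inv n G c H -> step n c l = Some (c', ev) ->
  exists2 G', ghosts_le G G' & sys_inv n G' c' (H ++ oapp (cons^~ [::]) [::] ev).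
Proof.
move=> I st; have N' := net_inv_step (inv_net I) st.
have N := inv_net I; have loc := inv_local I.
case: (stepP (net_uniq N) st) N' => {st l c' ev}.
- move=> i op s out lin nb eo N'.
  have re : responses (cst c i) = [::].
    case e: (responses _) => [//|x r].
    have xn : x.2 < n by apply: (net_resp_pid N (i := i)); rewrite e mem_head.
    by have := net_count N i xn; rewrite e (negbTE nb) /= eqxx; lia.
  have [g [le lg po]] := invoke_step (loc i) nb re eo.
  by exists (fupd G i g); [apply: ghosts_le_fupd|apply: inv_update].
- move=> p net s out res pm er N'.
  have memp : p \in cnet c by rewrite (perm_mem pm) mem_head.
  have sub : {subset net <= cnet c} by move=> x xn; rewrite (perm_mem pm) inE xn orbT.
  have [sn dn] := net_pid N memp.
  have pk := inv_pkt I memp.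
  suff [g [le lg po]] : exists g, good_step n G (pkt_dst p) g s
      (proj (pkt_dst p) H ++ oapp (fun r => [:: EvResp (pkt_dst p) r]) [::] res) out.
    exists (fupd G (pkt_dst p) g); first exact: ghosts_le_fupd.
    by apply: inv_update => //; case: (res) lg.
  have locE k : exists sk hk, local_inv n G k sk hk by exists (cst c k), (proj k H).
  have un : uniq (map snd (responses (cst c (pkt_dst p)))).
    exact: net_resp_uniq N.
  have fresh x := net_recv_fresh x N pm.
  case em: (pkt_msg p) er pk fresh => [l rd r|l rd y|l rd r x|l rd] er pk fresh.
  + by have := query_step (loc (pkt_dst p)) pk; case: er => <- <- <-; rewrite cats0.
  + have [erd|nrd] := eqVneq (rid (cst c (pkt_dst p))) rd; last first.
      move: er => /=; rewrite (negbTE nrd) => -[<- <- <-]; rewrite cats0.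
      by exists (G (pkt_dst p)); apply: good_step_idle.
    have [_ [ea nin]] := fresh (Some y) isT erd.
    rewrite -erd in er pk; have := response_step (j := pkt_src p) locE (loc (pkt_dst p)) (y := y) (l' := l).
    cbv zeta; rewrite er; apply=> //; first by rewrite ea /= nin.
    by move=> e; rewrite ea inE => /orP [/eqP -> //|/(net_resp_pid N)].
  + by have := update_step (loc (pkt_dst p)) (loc (pkt_src p)) pk;
      case: er => <- <- <-; rewrite cats0.
  have [erd|nrd] := eqVneq (rid (cst c (pkt_dst p))) rd; last first.
    move: er => /=; rewrite (negbTE nrd) => -[<- <- <-]; rewrite cats0.
    by exists (G (pkt_dst p)); apply: good_step_idle.
  have [_ [ea nin]] := fresh None isT erd.
  rewrite -erd in er pk; have := ack_step (j := pkt_src p) (loc (pkt_dst p)) (l' := l).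
  cbv zeta; rewrite er; apply=> //; first by rewrite ea /= nin.
  by move=> e; rewrite ea inE => /orP [/eqP -> //|/(net_resp_pid N)].
- move=> i N'; exists G; first exact: ghosts_le_refl.
  by rewrite cats0; split=> //; apply: inv_pkt I.
by move=> _; exists G; [apply: ghosts_le_refl|rewrite cats0].
Qed.

(** * Sequential consistency *)

Lemma inv_run n G c H ls c' H' : sys_inv n G c H -> run n c ls = Some (c', H') ->
  exists G', sys_inv n G' c' (H ++ H').
Proof.
elim: ls G c H H' => [|l ls IH] G c H H' I /=.
  by case=> <- <-; exists G; rewrite cats0.
case st: step => [[c1 e]|//]; case er: run => [[c2 h]|//] [ec <-].
have [G1 _ I1] := inv_step I st; rewrite ec in er; have [G2 I2] := IH _ _ _ _ I1 er.
by exists G2; move: I2; rewrite -catA; case: (e).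
Qed.

Section Quiescent.
Variables (n : nat) (G : pid -> ghost) (c : config) (H : seq event).
Hypothesis I : sys_inv n G c H.

(** A pending invocation would be the last event of its process, leaving no place for the response
    that completeness requires. *)
Lemma complete_idle i : complete H -> reqs (G i) (rid (cst c i)) = None.
Proof.
move=> comp; have := loc_hist (inv_local I i); case: (reqs _ _) => [q|//] eh.
have := comp i (size (events (ops (G i)))) i (q_op q).
rewrite eh !onthE map_cat nth_cat size_map ltnn subnn /=.
case=> // r [].
by rewrite nth_cat size_map ltnNge leqnSn /= subSnn.
Qed.

Lemma resp_before_inv_tsv i j a b : a \in ops (G i) -> b \in ops (G j) ->
  o_reg a = o_reg b -> o_resp a < o_inv b ->
  if o_write b then ~~ tsv_le (o_tsv b) (o_tsv a) else tsv_le (o_tsv a) (o_tsv b).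
Proof.
move=> ai bj er lt.
have [_ oka _] := loc_ops (inv_local I i) ai; have [_ okb _] := loc_ops (inv_local I j) bj.
have [_] := op_req okb; have [qs [us ls zs hs]] := op_acks oka.
have := er; rewrite /o_write {2}/o_reg /=; case: (o_op b) => /= [r era|r v _ [eb _]].
  case=> qt [ut lt' zt ht].
  have [q /hs [t [ta ul]] /ht [t' [y [tb yb ql]]]] := quorum_intersect us ut ls lt' zs zt.
  rewrite era in ul; apply: tsv_le_trans yb.
  apply: (loc_log (inv_local I q) ul ql).
  exact: ltn_trans ta (ltn_trans lt tb).
by apply: tsv_lt_clock; rewrite eb /=; apply: ltn_trans (op_tsv_resp oka) lt.
Qed.

Lemma idle_seq_consistent :
  (forall i, reqs (G i) (rid (cst c i)) = None) -> seq_consistent H.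
Proof.
move=> idle; set s := flatten [seq ops (G i) | i <- iota 0 n].
have mems o : o \in s -> exists2 i, op_ok n G i o & o \in ops (G i).
  case/flattenP => t /mapP [i _ ->] oi; exists i => //.
  by have [] := loc_ops (inv_local I i) oi.
have sP i o : o \in ops (G i) -> o \in s.
  move=> oi; have [lin _ _] := loc_ops (inv_local I i) oi.
  by apply/flattenP; exists (ops (G i)) => //; apply: map_f; rewrite mem_iota.
have pidE i o : o \in ops (G i) -> o_pid o = i.
  by move=> oi; have [_ /op_pid] := loc_ops (inv_local I i) oi.
have filt i : [seq o <- s | o_pid o == i] = ops (G i).
  have fE k : [seq o <- ops (G k) | o_pid o == i] = if k == i then ops (G i) else [::].
    case: eqP => [->|ne]; first by apply/all_filterP/allP => o /pidE ->.
    apply/eqP; rewrite -[_ == _]negbK -has_filter; apply/hasPn => o /pidE ->.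
    exact/eqP.
  rewrite /s filter_flatten -map_comp (eq_map (fE : _ =1 _)).
  have [lin|ge] := ltnP i n; last first.
    have -> : ops (G i) = [::].
      case e: (ops (G i)) => [//|o os].
      have := loc_ops (inv_local I i) (o := o); rewrite e mem_head => /(_ isT) [lt].
      by rewrite ltnNge ge in lt.
    by elim: (iota 0 n) => //= k t ->; rewrite if_same.
  have := iota_uniq 0 n; have : i \in iota 0 n by rewrite mem_iota.
  elim: (iota 0 n) => //= k t IH; rewrite inE => /orP [/eqP <-|it] /andP [nin un].
    rewrite eqxx; suff -> : flatten [seq if k0 == i then ops (G i) else [::] | k0 <- t] = [::].
      by rewrite cats0.
    elim: t nin {IH un} => //= k' t IH; rewrite inE negb_or => /andP [ne nin].
    by rewrite eq_sym (negbTE ne) IH.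
  rewrite IH //; case: eqP => // e; by rewrite e it in nin.
have [s' [leg ord]] : exists s', [/\ legal (events s') &
  forall p, sorted (fun a b => o_resp a < o_inv b) (filter p s) -> filter p s' = filter p s].
  apply: linearization.
  - by move=> o /mems [i /op_inv_resp].
  - by move=> a b /mems [i _ ai] /mems [j _ bj]; apply: resp_before_inv_tsv ai bj.
  - move=> o r v /mems [i /op_req [_ /=] h _] eo; move: h; rewrite eo => -[-> _] //.
  - move=> o /mems [i /op_req [/= w _] _] _.
    (* A pair read comes from a write request; with none pending, that write is among the completed
       operations. *)
    case: w => [->|[j [rd [a [v e]]]]]; [by left|right].
    have [erd|[w wj [ew et]]] := loc_write (inv_local I j) e; first by rewrite erd idle in e.
    by exists w; rewrite ?(sP j) // /o_write /o_reg ew.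
  move=> o /mems [i /op_req [_ /=] h _]; rewrite /o_write.
  by case: (o_op o) h => // r v [-> lt] _; apply: tsv_lt_clock.
exists (events s'); split=> //; first exact: sequential_events.
move=> i; rewrite proj_events ord filt; first by rewrite (loc_hist (inv_local I i)) idle cats0.
exact: loc_sorted (inv_local I i).
Qed.

End Quiescent.

Lemma sequential_consistency n f : SequentialConsistency n f.
Proof.
move=> ls c H er _ comp; have [G I] := inv_run (inv_init n) er.
by apply: (idle_seq_consistent I) => i; apply: (complete_idle I).
Qed.

(** * Termination *)

(** Replies may be added but not lost, so a server once recorded stays recorded along stable
    steps. *)
Definition stable (s s' : pstate) : bool :=
  [&& rid s' == rid s, busy s' == busy s & all (mem (responses s')) (responses s)].

Lemma stable_refl s : stable s s.
Proof. by rewrite /stable !eqxx; apply/allP. Qed.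

Lemma sub_add_resp x s : all (mem (add_resp x s)) s.
Proof. by apply/allP => e es; rewrite inE /add_resp; case: ifP => // _; rewrite inE es orbT. Qed.

(** The update case keeps the response that triggered it; [busy_returns] uses it to exclude a second
    passage to an update phase. *)
Variant client_step (i : pid) (c c' : config) (ev : option event) : Prop :=
| ClientStable of stable (cst c i) (cst c' i)
| ClientIdle of ~~ busy (cst c i)
| ClientReturn r of ev = Some (EvResp i r)
| ClientUpdate p l y p' l' r x of p \in cnet c & pkt_dst p = i
    & pkt_msg p = MResponse l (rid (cst c i)) y
    & p' \in cnet c' & pkt_src p' = i
    & pkt_msg p' = MUpdate l' (rid (cst c' i)) r x.

Lemma client_stepP n i c l c' ev : net_inv n c -> step n c l = Some (c', ev) ->
  client_step i c c' ev.
Proof.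
move=> N /(stepP (net_uniq N)) [].
- move=> j op s out lin nb _; have [ej|ne] := eqVneq i j; first by apply: ClientIdle; rewrite ej.
  by apply: ClientStable; rewrite /= fupd_neq // stable_refl.
- move=> p net s out res pm er.
  have memp : p \in cnet c by rewrite (perm_mem pm) mem_head.
  have [ei|ne] := eqVneq i (pkt_dst p); last first.
    by apply: ClientStable; rewrite /= fupd_neq // stable_refl.
  have n0 : 0 < n by have [_] := net_pid N memp; case: (n).
  rewrite -ei in er; case em: (pkt_msg p) er => [l0 rd r|l0 rd y|l0 rd r x|l0 rd] /=.
  + by case=> <- <- _; apply: ClientStable; rewrite /= -ei fupd_eq /stable /= !eqxx; apply/allP.
  + case: eqP => [erd|_]; last by case=> <- <- _; apply: ClientStable; rewrite /= -ei fupd_eq stable_refl.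
    case: ifP => _ [<- <- <-]; last first.
      by apply: ClientStable; rewrite /= -ei fupd_eq /stable /= !eqxx sub_add_resp.
    rewrite -erd in em; rewrite -ei; set m := MUpdate _ _ _ _.
    set s1 := PState _ _ _ _ _ _ _ _.
    (* Any copy of the broadcast will do; the one for process [0] exists since [n] is positive. *)
    have := @mk_packets_has (cnext c) i (bcast n m) 0 m.
    have mb : (0, m) \in bcast n m by apply: map_f; rewrite mem_iota.
    case=> // p' mp' [e1 _ e2].
    eapply ClientUpdate with (p' := p'); [exact: memp|by []|exact: em| |by []|].
      by rewrite mem_cat mp' orbT.
    by rewrite /= fupd_eq; exact: e2.
  + by case=> <- <- _; apply: ClientStable; rewrite /= -ei fupd_eq /stable /= !eqxx; apply/allP.
  case: eqP => [erd|_]; last by case=> <- <- _; apply: ClientStable; rewrite /= -ei fupd_eq stable_refl.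
  case: ifP => _ [<- <- <-]; last first.
    by apply: ClientStable; rewrite /= -ei fupd_eq /stable /= !eqxx sub_add_resp.
  by rewrite -ei; apply: ClientReturn; reflexivity.
- by move=> j; apply: ClientStable; apply: stable_refl.
by apply: ClientStable; apply: stable_refl.
Qed.

Lemma invoked_busy n c l c' ev i op : net_inv n c -> step n c l = Some (c', ev) ->
  ev = Some (EvInv i op) -> busy (cst c' i).
Proof.
move=> N /(stepP (net_uniq N)) [] //=; last by move=> p net s out [].
move=> j op' s out _ _ eo [<- _]; rewrite fupd_eq.
by case: op' eo => [r|r v] [<- _].
Qed.

Definition delivers (k : nat) (l : label) : bool := if l is LDeliver k' then k' == k else false.

Lemma packet_kept n c l c' ev p : net_inv n c -> step n c l = Some (c', ev) ->
  p \in cnet c -> ~~ delivers (pkt_id p) l -> p \in cnet c'.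
Proof.
move=> N /(stepP (net_uniq N)) [] //=.
- by move=> i op s out _ _ _ pc _; rewrite mem_cat pc.
move=> p0 net s out res pm _; rewrite (perm_mem pm) inE mem_cat => /orP [/eqP ->|->//].
by rewrite eqxx.
Qed.

Lemma packet_delivered n c l c' ev p : net_inv n c -> step n c l = Some (c', ev) ->
  p \in cnet c -> delivers (pkt_id p) l -> exists net s out res,
  on_receive n (pkt_dst p) (cst c (pkt_dst p)) (pkt_src p) (pkt_msg p) = (s, out, res) /\
  c' = update c net (pkt_dst p) s out.
Proof.
move=> N /(stepP (net_uniq N)) [] //= p0 net s out res pm er mem /eqP eid.
have mem0 : p0 \in cnet c by rewrite (perm_mem pm) mem_head.
suff -> : p = p0 by exists net, s, out, res.
have un := net_uniq N.
apply/eqP; rewrite -(nth_index p mem) -(nth_index p mem0) nth_uniq ?index_mem ?(map_uniq un) //.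
rewrite -(nth_uniq 0 _ _ un) ?size_map ?index_mem //.
by rewrite !(nth_map p) ?index_mem // !nth_index // eid.
Qed.

Lemma crashed_mono n c l c' ev q : uniq (map pkt_id (cnet c)) -> step n c l = Some (c', ev) ->
  ccrashed c q -> ccrashed c' q.
Proof. by move=> un /(stepP un) [] //= i; rewrite /fupd; case: ifP. Qed.

Lemma count_mem_le_size (T : eqType) (s t : seq T) : uniq t -> count (mem s) t <= size s.
Proof.
move=> ut; rewrite -size_filter; apply: uniq_leq_size; first exact: filter_uniq.
by move=> x; rewrite mem_filter => /andP [].
Qed.

Lemma eventually_forall n (P : nat -> nat -> Prop) :
  (forall q, q < n -> exists k, forall j, k <= j -> P q j) ->
  exists k, forall j, k <= j -> forall q, q < n -> P q j.
Proof.
elim: n => [|n IH] h; first by exists 0.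
have [k hk] := IH (fun q lt => h q (ltnW lt)); have [k' hk'] := h n (ltnSn n).
exists (maxn k k') => j; rewrite geq_max => /andP [kj kj'] q.
by rewrite ltnS leq_eqVlt => /orP [/eqP ->|/(hk _ kj)] //; apply: hk'.
Qed.

(** * Executions with reliable links *)

Section Executions.
Variables (n f : nat) (c : nat -> config) (ls : nat -> label) (ev : nat -> option event).
Hypothesis f_small : 2 * f < n.
Hypothesis ex : is_execution n c ls ev.
Hypothesis few_crashes : forall k, ncrashed n (c k) <= f.
Hypothesis links : reliable_links c ls.

Lemma exec_inv k : exists G H, sys_inv n G (c k) H.
Proof.
have [c0 st] := ex; elim: k => [|k [G [H I]]].
  by exists (fun _ => ghost_init), [::]; rewrite c0; apply: inv_init.
by have [G' _ I'] := inv_step I (st k); exists G'; eexists; exact: I'.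
Qed.

Lemma exec_net_inv k : net_inv n (c k).
Proof. by have [G [H /inv_net]] := exec_inv k. Qed.

Lemma exec_step k : step n (c k) (ls k) = Some (c k.+1, ev k).
Proof. by have [_] := ex. Qed.

Lemma delivery k p : p \in cnet (c k) -> correct_in c (pkt_src p) -> correct_in c (pkt_dst p) ->
  exists2 k', k <= k' & exists net s out res,
  on_receive n (pkt_dst p) (cst (c k') (pkt_dst p)) (pkt_src p) (pkt_msg p) = (s, out, res) /\
  c k'.+1 = update (c k') net (pkt_dst p) s out.
Proof.
move=> mem cs cd; have spl : exists s1 s2, cnet (c k) = s1 ++ p :: s2.
  by case/splitPr: mem => s1 s2; exists s1, s2.
have exd : exists k', (k <= k') && delivers (pkt_id p) (ls k').
  by have [k' [le e]] := links spl cs cd; exists k'; rewrite le e /= eqxx.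
(* The first delivery step is chosen because the packet is still in the network until then. *)
case: (ex_minnP exd) => m /andP [km dm] minm.
exists m => //; apply: (packet_delivered (exec_net_inv m) (exec_step m)) => //.
have {km} : k <= m <= m by rewrite km /=.
move: {1 2 4}m => j; elim: j => [|j IH] /andP [kj jm].
  by move: kj; rewrite leqn0 => /eqP <-.
move: kj; rewrite leq_eqVlt => /orP [/eqP <- //|kj].
apply: (packet_kept (exec_net_inv j) (exec_step j)); first by apply: IH; rewrite -ltnS kj ltnW.
by apply/negP => dj; have := minm j; rewrite dj -ltnS kj => /(_ isT); rewrite leqNgt jm.
Qed.

Section Client.
Variable i : pid.
Hypothesis ci : correct_in c i.

Lemma stable_range k m : k <= m ->
  (forall j, k <= j < m -> stable (cst (c j) i) (cst (c j.+1) i)) ->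
  stable (cst (c k) i) (cst (c m) i).
Proof.
elim: m => [|m IH]; first by rewrite leqn0 => /eqP -> _; apply: stable_refl.
rewrite leq_eqVlt => /orP [/eqP -> _|km st]; first exact: stable_refl.
have /and3P [/eqP r1 /eqP b1 /allP s1] : stable (cst (c k) i) (cst (c m) i).
  by apply: IH => // j /andP [kj jm]; apply: st; rewrite kj ltnW ?ltnS // ltnW.
have /and3P [/eqP r2 /eqP b2 /allP s2] : stable (cst (c m) i) (cst (c m.+1) i).
  by apply: st; rewrite -ltnS km ltnSn.
by rewrite /stable r2 b2 r1 b1 !eqxx; apply/allP => e /s1 /s2.
Qed.

(** If all steps were stable, every server would end up crashed or recorded. At most [f] are crashed
    and at most [n./2] recorded, which together is less than [n]. *)
Lemma client_unstable k : busy (cst (c k) i) ->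
  exists j, (k <= j) && ~~ stable (cst (c j) i) (cst (c j.+1) i).
Proof.
move=> bk; apply: NNPP => nex.
have st j : k <= j -> stable (cst (c j) i) (cst (c j.+1) i).
  by move=> kj; apply: contraT => ns; case: nex; exists j; rewrite kj ns.
have str j m : k <= j -> j <= m -> stable (cst (c j) i) (cst (c m) i).
  move=> kj jm; apply: stable_range => // j' /andP [jj' _].
  by apply: st; apply: leq_trans jj'.
set rd := rid (cst (c k) i).
have ridE j : k <= j -> rid (cst (c j) i) = rd.
  by move=> kj; have /and3P [/eqP] := str k j (leqnn k) kj.
have kept q j m : k <= j -> j <= m -> q \in map snd (responses (cst (c j) i)) ->
    q \in map snd (responses (cst (c m) i)).
  move=> kj jm /mapP [e mem ->]; have /and3P [_ _ /allP sub] := str j m kj jm.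
  exact: (map_f snd (sub _ mem)).
have reply j p q : k <= j -> p \in cnet (c j) -> ~~ is_request (pkt_msg p) ->
    pkt_concerns i rd q p -> correct_in c q ->
    (* A delivered reply is recorded: had it completed the quorum, the identifier would have changed
       and the step would not be stable. *)
    exists K, forall m, K <= m -> q \in map snd (responses (cst (c m) i)).
  move=> kj mem /negbTE nreq; rewrite /pkt_concerns /concerns nreq => /and3P [/eqP er /eqP ed /eqP es] cq.
  have := delivery mem; rewrite es ed => /(_ cq ci) [j' jj' [net [s [out [res [erec ec]]]]]].
  have kj' := leq_trans kj jj'.
  exists j'.+1 => m /(kept q) -> //; first exact: leqW.
  have := st j' kj'; rewrite ec /= fupd_eq.
  case: (pkt_msg p) nreq er erec => //= [l rd' y|l rd'] _ ->; rewrite ridE // eqxx;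
    case: ifP => _ [<- _ _]; rewrite /stable /= ?ridE ?(gtn_eqF (ltnSn _)) //= => _;
    by rewrite /add_resp; case: ifP => [/(map_f snd)//|_]; rewrite mem_head.
have each q : q < n -> exists K, forall m, K <= m ->
    ccrashed (c m) q \/ q \in map snd (responses (cst (c m) i)).
  move=> qn; have [cq|/not_all_ex_not [K /negP]] := classic (correct_in c q); last first.
    rewrite negbK => crK; exists K => m Km; left; rewrite -(subnKC Km).
    elim: (m - K) => [|d IH]; first by rewrite addn0.
    rewrite addnS; apply: crashed_mono IH; [|exact: exec_step].
    exact: net_uniq (exec_net_inv _).
  suff [K hK] : exists K, forall m, K <= m -> q \in map snd (responses (cst (c m) i)).
    by exists K => m /hK; right.
  have := net_count (exec_net_inv k) i qn; rewrite bk -/rd.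
  (* By [net_count], if nothing is in transit between the client and [q], then [q] is recorded
     already; otherwise a request in transit becomes a reply. *)
  have [has|/hasPn none] := boolP (has (pkt_concerns i rd q) (cnet (c k))); last first.
    rewrite (_ : count _ _ = 0) ?add0n => [e|]; last first.
      by apply/eqP; rewrite -leqn0 leqNgt -has_count; apply/hasPn.
    exists k => m km; apply: (kept q k m) => //.
    by rewrite -has_pred1 has_count e.
  move=> _; case/hasP: has => p mem con.
  have [req|nreq] := boolP (is_request (pkt_msg p)); last exact: reply mem nreq con cq.
  move: (con); rewrite /pkt_concerns /concerns req => /and3P [/eqP er /eqP es /eqP ed].
  have := delivery mem; rewrite es ed => /(_ ci cq) [j kj [net [s [out [res [erec ec]]]]]].
  have [m [m0 [mreq mrid]]] : exists m, out = [:: (i, m)] /\ ~~ is_request m /\ msg_rid m = rd.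
    case: (pkt_msg p) req er erec => //= [l rd' r|l rd' r x] _ -> [_ <- _].
      by eexists (MResponse _ _ _).
    by eexists (MAck _ _).
  apply: (reply j.+1 (Packet (cnext (c j)) q i m)) => //=; first exact: leqW.
    by rewrite ec /= m0 mem_cat mem_head orbT.
  by rewrite /pkt_concerns /concerns (negbTE mreq) /= mrid !eqxx.
have [K hK] := eventually_forall each.
have {hK} all_in := hK K (leqnn K).
have : size (iota 0 n) <= count (ccrashed (c K)) (iota 0 n) +
    count (mem (map snd (responses (cst (c K) i)))) (iota 0 n).
  rewrite -count_predUI; apply: leq_trans (leq_addr _ _).
  rewrite -(count_predT (iota 0 n)); apply: eq_leq; apply: eq_in_count => q.
  by rewrite mem_iota /= => qn; case: (all_in q qn) => ->; rewrite ?orbT.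
have := count_mem_le_size (map snd (responses (cst (c K) i))) (iota_uniq 0 n).
have := net_resp_size (exec_net_inv K) i; have := few_crashes K.
rewrite size_iota size_map /ncrashed /quorum; move: f_small; lia.
Qed.

Lemma client_progress k : busy (cst (c k) i) -> exists j, [/\ k <= j,
  stable (cst (c k) i) (cst (c j) i) & ~~ stable (cst (c j) i) (cst (c j.+1) i)].
Proof.
move=> /client_unstable exj; case: (ex_minnP exj) => j /andP [kj ns] minj.
exists j; split=> //; apply: stable_range => // m /andP [km mj].
by apply: contraT => nsm; have := minj m; rewrite km nsm => /(_ isT); rewrite leqNgt mj.
Qed.

(** History variables are only known to exist at each configuration, so the request is carried along
    a growing chain of them. *)
Lemma request_persists k j op a x :
  (exists G H, sys_inv n G (c k) H /\ reqs (G i) (rid (cst (c k) i)) = Some (Req op a (Some x))) ->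
  k <= j -> exists G H, sys_inv n G (c j) H /\
    reqs (G i) (rid (cst (c k) i)) = Some (Req op a (Some x)).
Proof.
move=> exG kj; rewrite -(subnKC kj); elim: (j - k) => [|d [G [H [I e]]]]; first by rewrite addn0.
rewrite addnS; have [G' GG I'] := inv_step I (exec_step _).
by exists G'; eexists; split; [exact: I'|apply: (reqs_mono GG)].
Qed.

(** The first unstable step returns or opens an update phase; in the latter case the next unstable
    step must return. *)
Lemma busy_returns k : busy (cst (c k) i) ->
  exists j r, k <= j /\ ev j = Some (EvResp i r).
Proof.
move=> bk; have [j [kj sj nsj]] := client_progress bk.
have bj : busy (cst (c j) i) by have /and3P [_ /eqP ->] := sj.
case: (client_stepP i (exec_net_inv j) (exec_step j)); [by rewrite (negbTE nsj)|by rewrite bj| |].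
  by move=> r e; exists j, r.
move=> _ _ _ p l r x _ _ _ mem es em.
have [G [H I]] := exec_inv j.+1.
have := inv_pkt I mem; rewrite em es => -[op [a [e _ _]]].
have bj' : busy (cst (c j.+1) i) by rewrite (loc_busy (inv_local I i)) e.
have [m [jm sm nsm]] := client_progress bj'.
have bm : busy (cst (c m) i) by have /and3P [_ /eqP ->] := sm.
case: (client_stepP i (exec_net_inv m) (exec_step m)); [by rewrite (negbTE nsm)|by rewrite bm| |].
  by move=> r' e'; exists m, r'; split=> //; apply: leq_trans kj (ltnW jm).
(* A response with the current identifier would need a query recorded under it, but
   [request_persists] finds an update there. *)
move=> q l' y _ _ _ _ memq ed emq _ _ _.
have [|G' [H' [I' e']]] := @request_persists j.+1 m op a x _ jm; first by exists G, H.
have := inv_pkt I' memq; rewrite emq ed => -[op' [a' [t [e'' _ _ _]]]].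
by have /and3P [/eqP er _ _] := sm; rewrite er e' in e''.
Qed.

End Client.
End Executions.

Lemma termination n f : 2 * f < n -> Termination n f.
Proof.
move=> small c ls ev ex crashes links k i op einv ci.
have bk : busy (cst (c k.+1) i).
  by apply: invoked_busy (exec_net_inv ex k) (exec_step ex k) einv.
have [j [r [kj e]]] := busy_returns small ex crashes links ci bk.
by exists j, r.
Qed.

Theorem theorem1 (n f : nat) :
  (2 * f < n)%N -> Termination n f /\ SequentialConsistency n f.
Proof. by move=> small; split; [apply: termination | apply: sequential_consistency]. Qed.
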